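(* Let $p$ be a prime, let $k\geq 3$, let $0<\varepsilon<1$ and set $\delta=\varepsilon^{C_{p,k}}$. Let $n\geq1$ and $X_1,\dots,X_k\subseteq\mathbb{F}_p^n$ be such that there is a collection of at least $\varepsilon N$ pairwise disjoint $k$-cycles in $X_1\times\dots\times X_k$. Then the total number of $k$-cycles $(x_1,\dots,x_k)\in X_1\times\dots\times X_k$ is at least $\delta N^{k-1}$.
   Context: Let $p$ be a fixed prime, $n\geq 1$, and $N=p^n$. For sets $X_1,\dots,X_k\subseteq\mathbb{F}_p^n$, a $k$-cycle is a $k$-tuple $(x_1,\dots,x_k)\in X_1\times\dots\times X_k$ with $x_1+\dots+x_k=0$. Two $k$-cycles $(x_1,\dots,x_k)$ and $(x_1',\dots,x_k')$ are called disjoint if $x_i\neq x_i'$ for every $i=1,\dots,k$. Define $0<c_{p,3}<1$ by $\inf_{0<t<1}\frac{t^0+t^1+\dots+t^{p-1}}{t^{(p-1)/3}}=p^{1-c_{p,3}}$, set $C_{p,3}=1+\frac{1}{c_{p,3}}$, and for $k\geq 3$ set $C_{p,k}=(k-2)(C_{p,3}-1)+1$. *)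

(* Defs.v *)
From HB Require Import structures.
From mathcomp Require Import all_boot all_order all_algebra.
Set Implicit Arguments.
Unset Strict Implicit.
Unset Printing Implicit Defensive.

Import GRing.Theory.

Definition is_kcycle (p n k : nat) (X : 'I_k -> {set 'rV['F_p]_n})
  (x : {ffun 'I_k -> 'rV['F_p]_n}) : bool :=
  [forall i, x i \in X i] && ((\sum_(i < k) x i)%R == 0%R).

Definition disjoint_tuples (p n k : nat)
  (x y : {ffun 'I_k -> 'rV['F_p]_n}) : bool :=
  [forall i, x i != y i].

Definition disjoint_cycle_collection (p n k : nat) (X : 'I_k -> {set 'rV['F_p]_n})
  (S : {set {ffun 'I_k -> 'rV['F_p]_n}}) : Prop :=
  (forall x, x \in S -> is_kcycle X x) /\
  (forall x y, x \in S -> y \in S -> x != y -> disjoint_tuples x y).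

Definition num_kcycles (p n k : nat) (X : 'I_k -> {set 'rV['F_p]_n}) : nat :=
  #|[set x : {ffun 'I_k -> 'rV['F_p]_n} | is_kcycle X x]|.

From Stdlib Require Import Reals.

Local Open Scope R_scope.

Definition is_glb_R (E : R -> Prop) (g : R) : Prop :=
  (forall y, E y -> g <= y) /\ (forall b, (forall y, E y -> b <= y) -> b <= g).

Definition cp3_fun (p : nat) (t : R) : R :=
  sum_f_R0 (fun i => t ^ i) (p - 1)%nat / Rpower t ((INR p - 1) / 3).

Definition is_c_p3 (p : nat) (c : R) : Prop :=
  is_glb_R (fun y => exists t, 0 < t < 1 /\ y = cp3_fun p t) (Rpower (INR p) (1 - c)).

Definition C_p3 (c : R) : R := 1 + 1 / c.
Definition C_pk (c : R) (k : nat) : R := (INR k - 2) * (C_p3 c - 1) + 1.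

(* Main.v *)
(** Three-cycles: the slice rank of the indicator of [x + y + z = 0] bounds a
tricoloured sum-free set in [F_p^d] by [3 p^((1-c)d)].  Pulling the triangles of
[X 0 x X 1 x X 2] back along a random affine map [F_p^d -> F_p^n], with [p^d] about
[N / (6 Delta)] where [Delta] bounds the degrees, leaves at least half of them isolated, so
there are [O(N^2 (Delta/N)^(1+c))] triangles.  Deleting high-degree elements at
dyadic scales gives a geometric series, hence a matching of size [M] forces
[>> N^2 (M/N)^(1+1/c)] triangles.

More cycles: merge [x_1] and [x_2] into [y = x_1 + x_2] and induct on [k].  The
three-cycle case shows that most sums [y] have [>> (M/N)^(1/c) N] representations,
provided that the sums along the matching are distinct.  One can arrange, at the
price of a factor [log M], that the [x_1 + x_2] or the [x_1 + x_3] are distinct.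
Otherwise, after deleting few elements, both kinds of sums take few values
on all cycles.  Start from the uniform weight on the matching and resample
[(x_1, x_2)] and the rest independently given [x_1 + x_2], then [(x_1, x_3)] and the
rest given [x_1 + x_3], and so on, each time discarding the sums of small weight:
the largest weight of a pair of coordinates halves at every step while the total
weight stays at least half of [M], which is absurd after [log M] steps.

The loss accumulated in this way is polynomial in [n], and tensor powers remove it. *)
Require Import Defs.
From HB Require Import structures.
From mathcomp Require Import all_boot all_order all_algebra finfield zify.
Set Implicit Arguments.
Unset Strict Implicit.
Unset Printing Implicit Defensive.
Import Order.TTheory GRing.Theory Num.Theory.

(** * Tricoloured sum-free sets *)

Section SliceRank.
Local Open Scope ring_scope.
Variable F : fieldType.

Lemma mxrank_mxsub (m n m' n' : nat) (f : 'I_m' -> 'I_m) (g : 'I_n' -> 'I_n)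
  (A : 'M[F]_(m, n)) : (\rank (mxsub f g A) <= \rank A)%N.
Proof.
have -> : mxsub f g A = rowsub f 1%:M *m A *m colsub g 1%:M.
  by rewrite mul_rowsub_mx mul1mx mulmx_colsub mulmx1; apply/matrixP => i j; rewrite !mxE.
exact: leq_trans (mxrankM_maxl _ _) (mxrankM_maxr _ _).
Qed.

(** A row-free matrix with [D] rows has [D] columns forming an invertible block; [v] is obtained by
    solving for the all-ones row on that block. *)
Lemma row_free_vector_large_support (m D : nat) (B : 'M[F]_(D, m)) :
  row_free B -> exists (v : 'rV[F]_D) (g : 'I_D -> 'I_m),
    injective g /\ forall s, (v *m B) 0 (g s) = 1.
Proof.
move=> Bfree.
have BTfull : row_full B^T by rewrite -col_leq_rank mxrank_tr row_leq_rank.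
have U := fullrowsub_unit BTfull.
exists (const_mx 1 *m invmx (rowsub (fullrankfun BTfull) B^T)^T), (fullrankfun BTfull).
split; first exact: fullrankfun_inj.
move=> s.
set g := fullrankfun BTfull; set v := _ *m invmx _.
transitivity ((colsub g (v *m B)) 0 s); first by rewrite [RHS]mxE.
rewrite -mulmx_colsub.
have -> : colsub g B = (rowsub g B^T)^T.
  by apply/matrixP => i j; rewrite !mxE.
by rewrite /v mulmxKV ?unitmx_tr // mxE.
Qed.

(** Contracting the first index with a vector [h] that annihilates every [f1 r] removes the first
    family of slices and leaves [diag_mx h], of rank at most [#|R2| + #|R3|]. Such an [h] can be
    chosen equal to 1 on at least [m - #|R1|] positions. *)
Lemma diagonal_slice_rank (m : nat) (R1 R2 R3 : finType)
  (f1 f2 f3 : _ -> 'I_m -> F) (g1 g2 g3 : _ -> 'I_m -> 'I_m -> F) :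
  (forall i j k, ((i == j) && (j == k))%:R =
     \sum_(r : R1) f1 r i * g1 r j k + \sum_(r : R2) f2 r j * g2 r i k
     + \sum_(r : R3) f3 r k * g3 r i j) ->
  (m <= #|R1| + #|R2| + #|R3|)%N.
Proof.
move=> slices.
pose F1 : 'M[F]_(m, #|R1|) := \matrix_(i, r) f1 (enum_val r) i.
have [v [g [g_inj vB1]]] := row_free_vector_large_support (row_base_free (kermx F1)).
set h := v *m _ in vB1.
have hF1 : h *m F1 = 0.
  apply/eqP; rewrite -sub_kermx; apply: submx_trans (submxMl _ _) _.
  by rewrite eq_row_base.
move: h vB1 hF1 => h vB1 hF1.
pose P2 : 'M[F]_(m, #|R2|) := \matrix_(j, r) f2 (enum_val r) j.
pose Q2 : 'M[F]_(#|R2|, m) := \matrix_(r, k) \sum_i h 0 i * g2 (enum_val r) i k.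
pose P3 : 'M[F]_(m, #|R3|) := \matrix_(j, r) \sum_i h 0 i * g3 (enum_val r) i j.
pose Q3 : 'M[F]_(#|R3|, m) := \matrix_(r, k) f3 (enum_val r) k.
have diagE : diag_mx h = P2 *m Q2 + P3 *m Q3.
  apply/matrixP => j k; rewrite !mxE.
  transitivity (\sum_i h 0 i * ((i == j) && (j == k))%:R).
    rewrite (bigD1 j) //= eqxx big1 ?addr0 => [|i ne_ij]; last by rewrite (negbTE ne_ij) mulr0.
    by rewrite mulr_natr.
  under eq_bigr => i _ do rewrite slices !mulrDr.
  rewrite !big_split /= -[RHS]add0r addrA; congr (_ + _ + _).
  - under eq_bigr => i _ do rewrite mulr_sumr.
    rewrite exchange_big big1 // => r _.
    have /matrixP/(_ 0 (enum_rank r)) := hF1.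
    rewrite !mxE => E0; transitivity (0 * g1 r j k); last by rewrite mul0r.
    rewrite -[X in X * _]E0 mulr_suml; apply: eq_bigr => i _.
    by rewrite mxE enum_rankK mulrA.
  - under eq_bigr => i _ do rewrite mulr_sumr.
    rewrite exchange_big (reindex (@enum_val _ R2)) /=; last first.
      exact/onW_bij/enum_val_bij.
    apply: eq_bigr => r _; rewrite !mxE mulr_sumr; apply: eq_bigr => i _.
    by rewrite mulrCA.
  - under eq_bigr => i _ do rewrite mulr_sumr.
    rewrite exchange_big (reindex (@enum_val _ R3)) /=; last first.
      exact/onW_bij/enum_val_bij.
    apply: eq_bigr => r _; rewrite !mxE mulr_suml; apply: eq_bigr => i _.
    by rewrite -mulrA [g3 _ _ _ * _]mulrC.
have rk_diag : (\rank (diag_mx h) <= #|R2| + #|R3|)%N.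
  rewrite diagE; apply: leq_trans (mxrank_add _ _) _.
  by apply: leq_add; [apply: leq_trans (mxrankM_maxl _ _) (rank_leq_col _) | apply: leq_trans (mxrankM_maxl _ _) (rank_leq_col _)].
(* The block of [diag_mx h] on the positions [g s] is an identity matrix of size the dimension of
   the kernel. *)
have : (\rank (kermx F1) <= \rank (diag_mx h))%N.
  rewrite -[leqLHS](mxrank1 F).
  suff -> : 1%:M = mxsub g g (diag_mx h) by apply: mxrank_mxsub.
  by apply/matrixP => s t; rewrite !mxE vB1 (inj_eq g_inj).
rewrite mxrank_ker => rk_ker.
have := leq_trans rk_ker rk_diag; rewrite leq_subLR => /leq_trans-> //.
by rewrite -addnA leq_add2r rank_leq_col.
Qed.
End SliceRank.

Section TricolouredBound.
Local Open Scope ring_scope.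
Variables (p d : nat).
Hypothesis p_prime : prime p.

(** Exponents of degree at most a third of [(p - 1) * d], the degree of the polynomial that detects
    [x + y + z = 0]. *)
Definition low_monomials : {set {ffun 'I_d -> 'I_p}} :=
  [set e : {ffun 'I_d -> 'I_p} | (3 * \sum_(j < d) e j <= (p - 1) * d)%N].

(** This polynomial detects a zero sum in one coordinate. Indexing its terms by a finite type lets a
    product over coordinates expand into a sum over functions into that type. *)
Lemma one_sub_pow_expansion (F : fieldType) : exists (K : finType) (a b c : K -> 'I_p) (q : K -> F),
  (forall s, q s != 0 -> (a s + b s + c s <= p - 1)%N) /\
  forall x y z : F, 1 - (x + y + z) ^+ (p - 1) =
     \sum_s q s * (x ^+ a s * y ^+ b s * z ^+ c s).
Proof.
have [m pE] : exists m, p = m.+1 by exists p.-1; rewrite prednK ?prime_gt0.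
rewrite pE subn1 /=.
(* [None] indexes the constant 1 and [Some (i, j)] the monomial x^(m-i) y^(i-j) z^j. *)
pose a (ij : 'I_m.+1 * 'I_m.+1) : 'I_m.+1 := inord (m - ij.1).
pose b (ij : 'I_m.+1 * 'I_m.+1) : 'I_m.+1 := inord (ij.1 - ij.2).
pose q (ij : 'I_m.+1 * 'I_m.+1) : F :=
  if (ij.2 <= ij.1)%N then - ('C(m, ij.1) * 'C(ij.1, ij.2))%:R else 0.
exists (option ('I_m.+1 * 'I_m.+1))%type.
exists (oapp a ord0), (oapp b ord0), (oapp snd ord0), (oapp q 1).
have aE ij : a ij = (m - ij.1)%N :> nat by rewrite inordK // ltnS leq_subr.
have bE ij : b ij = (ij.1 - ij.2)%N :> nat.
  by rewrite inordK // ltnS (leq_trans (leq_subr _ _)) // -ltnS.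
split=> [[[i j]|] //=|x y z].
  rewrite /q /=; case: leqP => [ji _|_]; last by rewrite eqxx.
  rewrite aE bE /=; have := ltn_ord i; lia.
rewrite (bigD1 None) //= mul1r !expr0 !mulr1; congr (_ + _).
rewrite (reindex_omap Some id) /=; last by case.
rewrite (eq_bigl predT) => [|i]; last by rewrite eqxx.
transitivity (\sum_(i < m.+1) \sum_(j < m.+1)
   q (i, j) * (x ^+ a (i, j) * y ^+ b (i, j) * z ^+ j)); last first.
  by rewrite pair_big; apply: eq_bigr => [[i j]] _.
rewrite -addrA exprDn -sumrN; apply: eq_bigr => i _.
rewrite exprDn mulr_sumr -sumrMnl -sumrN.
rewrite (big_ord_widen m.+1 (fun j => - (x ^+ (m - i) * (y ^+ (i - j) * z ^+ j *+ 'C(i, j)) *+ 'C(m, i)))) ?ltn_ord //.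
rewrite big_mkcond /=; apply: eq_bigr => j _.
rewrite /q aE bE /= ltnS; case: leqP => _; last by rewrite mul0r.
rewrite mulNr; congr (- _).
by rewrite mulr_natl mulrnAr -mulrnA mulnC mulrA.
Qed.

(** By Fermat the indicator of [x + y + z = 0] is a polynomial of degree at most [(p - 1) * d], so
    in each term one of the three monomials is low. Grouping terms by that monomial gives
    [3 * #|low_monomials|] slices of a diagonal tensor. *)
Lemma tricoloured_sum_free_bound (m : nat) (u v w : 'I_m -> 'rV['F_p]_d) :
  (forall i j k, (u i + v j + w k == 0) = (i == j) && (j == k)) ->
  (m <= 3 * #|low_monomials|)%N.
Proof.
move=> sum_free.
have [K [a [b [c [q [qdeg qE]]]]]] := one_sub_pow_expansion 'F_p.
pose R := {e : {ffun 'I_d -> 'I_p} | e \in low_monomials}.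
pose mon (e : {ffun 'I_d -> 'I_p}) (x : 'rV['F_p]_d) := \prod_j x 0 j ^+ e j.
pose ex (a : K -> 'I_p) (h : {ffun 'I_d -> K}) : {ffun 'I_d -> 'I_p} := [ffun j => a (h j)].
pose Q (h : {ffun 'I_d -> K}) := \prod_j q (h j).
have deltaE (x y z : 'rV['F_p]_d) : (x + y + z == 0)%:R =
    \sum_(h : {ffun 'I_d -> K}) Q h * (mon (ex a h) x * mon (ex b h) y * mon (ex c h) z).
  transitivity (\prod_j (1 - (x 0 j + y 0 j + z 0 j) ^+ (p - 1))).
    have [s0|s_neq0] := eqVneq; last first.
      have /eqP/rowP/eqfunP := s_neq0; rewrite negb_forall => /existsP[j].
      rewrite !mxE => sj; rewrite (bigD1 j) //=.
      suff -> : (x 0 j + y 0 j + z 0 j) ^+ (p - 1) = 1 by rewrite subrr mul0r.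
      have := expf_card (x 0 j + y 0 j + z 0 j); rewrite card_Fp // => E.
      by apply: (mulfI sj); rewrite mulr1 -exprS -[in RHS]E subn1 prednK ?prime_gt0.
    rewrite big1 // => j _; have /rowP/(_ j) := s0; rewrite !mxE => ->.
    by rewrite expr0n subn_eq0 leqNgt prime_gt1 // subr0.
  under eq_bigr => j _ do rewrite qE.
  rewrite bigA_distr_bigA; apply: eq_bigr => h _.
  rewrite big_split /=; congr (_ * _); rewrite !big_split /=.
  by congr (_ * _ * _); apply: eq_bigr => j _; rewrite ffunE.
rewrite (_ : 3 * _ = #|{: R}| + #|{: R}| + #|{: R}|)%N; last first.
  by rewrite card_sig (eq_card (B := low_monomials)) // !mulSn mul0n addn0 addnA.
(* Each term goes to the first variable in which it is low, so none is counted twice. *)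
pose T1 h := ex a h \in low_monomials.
pose T2 h := ~~ T1 h && (ex b h \in low_monomials).
pose T3 h := ~~ T1 h && (ex b h \notin low_monomials) && (ex c h \in low_monomials).
apply: (@diagonal_slice_rank _ m R R R
  (fun r i => mon (val r) (u i)) (fun r i => mon (val r) (v i)) (fun r i => mon (val r) (w i))
  (fun r j k => \sum_(h | T1 h && (ex a h == val r)) Q h * (mon (ex b h) (v j) * mon (ex c h) (w k)))
  (fun r i k => \sum_(h | T2 h && (ex b h == val r)) Q h * (mon (ex a h) (u i) * mon (ex c h) (w k)))
  (fun r i j => \sum_(h | T3 h && (ex c h == val r)) Q h * (mon (ex a h) (u i) * mon (ex b h) (v j)))) => i j k.
rewrite -sum_free deltaE.
rewrite (bigID T1) /= -addrA; congr (_ + _).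
  rewrite (partition_big (ex a) (fun e => e \in low_monomials)) //= big_sub.
  apply: eq_bigr => r _; rewrite mulr_sumr; apply: eq_bigr => h /andP[_ /eqP->].
  by rewrite !mulrA; congr (_ * _ * _); rewrite mulrC.
rewrite (bigID (fun h => ex b h \in low_monomials)) /=; congr (_ + _).
  rewrite (partition_big (ex b) (fun e => e \in low_monomials)) /= => [|h /andP[]//].
  rewrite big_sub.
  apply: eq_bigr => r _; rewrite mulr_sumr; apply: eq_bigr => h /andP[_ /eqP->].
  by rewrite [RHS]mulrCA; congr (_ * _); rewrite mulrCA mulrA.
rewrite (bigID (fun h => ex c h \in low_monomials)) /= [X in _ + X]big1 ?addr0.
  rewrite (partition_big (ex c) (fun e => e \in low_monomials)) /= => [|h /andP[]//].
  rewrite big_sub.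
  apply: eq_bigr => r _; rewrite mulr_sumr; apply: eq_bigr => h /andP[_ /eqP->].
  by rewrite [RHS]mulrCA; congr (_ * _); rewrite mulrC.
(* A term low in no variable would have degree above [(p - 1) * d], so its coefficient vanishes. *)
move=> h /andP[/andP[]]; rewrite /T1 !inE -!ltnNge => ha hb hc.
have [->|Qn0] := eqVneq (Q h) 0; first by rewrite mul0r.
have : (\sum_j ex a h j + \sum_j ex b h j + \sum_j ex c h j <= (p - 1) * d)%N.
  rewrite -!big_split /=; have -> : ((p - 1) * d = \sum_(j < d) (p - 1))%N.
    by rewrite sum_nat_const card_ord mulnC.
  apply: leq_sum => l _.
  rewrite !ffunE; apply: qdeg; apply: contraNneq Qn0 => q0.
  by rewrite /Q (bigD1 l) //= q0 mul0r.
have no_sol (A B C D : nat) : (A + B + C <= D -> D < 3 * A -> D < 3 * B -> D < 3 * C -> False)%N by lia.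
by move=> deg_le; case: (no_sol _ _ _ _ deg_le ha hb hc).
Qed.

End TricolouredBound.

Section GeneratingFunction.
Local Open Scope ring_scope.
(** Each low exponent vector contributes at least [s ^ ((p - 1) d)] to the generating function,
    which factors over coordinates. Here [s] stands for the cube root of [t], which keeps the
    exponents integral. *)
Lemma low_monomials_generating (F : realFieldType) (p d : nat) (s : F) :
  0 < s -> s <= 1 ->
  #|low_monomials p d|%:R * s ^+ ((p - 1) * d) <= (\sum_(i < p) s ^+ (3 * i)) ^+ d.
Proof.
move=> s0 s1.
have -> : (\sum_(i < p) s ^+ (3 * i)) ^+ d = \prod_(j < d) \sum_(i < p) s ^+ (3 * i).
  by rewrite prodr_const card_ord.
rewrite bigA_distr_bigA /= -sum1_card natr_sum mulr_suml.
apply: (@le_trans _ _ (\sum_(e in low_monomials p d) \prod_j s ^+ (3 * (e : {ffun 'I_d -> 'I_p}) j))).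
  apply: ler_sum => e; rewrite inE => e_low.
  rewrite mul1r -expr_sum -big_distrr /= (ler_wiXn2l (ltW s0) s1) //.
rewrite [leRHS](bigID (fun e => e \in low_monomials p d)) /= lerDl.
by apply: sumr_ge0 => e _; apply: prodr_ge0 => j _; rewrite exprn_ge0 ?ltW.
Qed.
End GeneratingFunction.

(** * Random affine sampling *)

Section Triangles.
Local Open Scope ring_scope.
Variable V : finZmodType.

(** A zero-sum triple is stored as its first two entries, so every pair in [V * V] is one and the
    third corner is derived. *)
Definition corner (i : 'I_3) (t : V * V) : V :=
  if i == 0 then t.1 else if i == 1 then t.2 else - (t.1 + t.2).

Definition triangles (X : 'I_3 -> {set V}) : {set V * V} :=
  [set t | [forall i, corner i t \in X i]].

Definition degree (X : 'I_3 -> {set V}) (i : 'I_3) (x : V) : nat :=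
  #|[set t in triangles X | corner i t == x]|.

Lemma ord3P (P : 'I_3 -> Prop) : P 0 -> P 1 -> P (2%:R) -> forall i, P i.
Proof.
by move=> P0 P1 P2 [[|[|[|//]]] lt_i3];
  [move: P0 | move: P1 | move: P2]; congr P; apply: val_inj.
Qed.

Lemma corner_sum (t : V * V) : corner 0 t + corner 1 t + corner 2%:R t = 0.
Proof. by rewrite /corner /= subrr. Qed.

Lemma corner_inj2 (i j : 'I_3) (t t' : V * V) : i != j ->
  corner i t = corner i t' -> corner j t = corner j t' -> t = t'.
Proof.
case: t t' => [x y] [x' y'].
elim/ord3P: i; elim/ord3P: j => //= _; rewrite /corner /=.
- by move=> <- <-.
- by move=> <- /oppr_inj/addrI <-.
- by move=> -> ->.
- by move=> <- /oppr_inj/addIr <-.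
- by move=> /oppr_inj E Ex; move: E; rewrite Ex => /addrI <-.
- by move=> /oppr_inj E Ex; move: E; rewrite Ex => /addIr <-.
Qed.

Lemma card_same_corner (i : 'I_3) (t : V * V) :
  (#|[set t' | corner i t' == corner i t]| <= #|V|)%N.
Proof.
have [j ij] : exists j : 'I_3, i != j.
  by case: (eqVneq i 0) => [->|i0]; [exists 1 | exists 0].
rewrite -(@card_in_imset _ _ (corner j)); first exact: max_card.
move=> t1 t2; rewrite !inE => /eqP e1 /eqP e2.
by apply: corner_inj2 ij _; rewrite e1 e2.
Qed.

Lemma same_corner_pairs (X : 'I_3 -> {set V}) (i : 'I_3) (Delta : nat) :
  (forall x, degree X i x <= Delta)%N ->
  (\sum_(s in triangles X) #|[set s' in triangles X | corner i s' == corner i s]|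
     <= #|triangles X| * Delta)%N.
Proof. by move=> degX; rewrite -sum_nat_const leq_sum // => s _; apply: degX. Qed.
End Triangles.

Section Sampling.
Local Open Scope ring_scope.
Variables (p n d : nat).
Hypothesis p_prime : prime p.
Notation V := 'rV['F_p]_n.
Notation U := 'rV['F_p]_d.
Notation M := 'M['F_p]_(d, n).
Notation map_data := (M * V * V)%type.

(* The linear part is an arbitrary matrix, possibly of small rank: this makes the image
   of a fixed triple exactly uniform, and no injectivity of the map is needed below. *)
Definition affine_triple (h : map_data) (t : U * U) : V * V :=
  (t.1 *m h.1.1 + h.1.2, t.2 *m h.1.1 + h.2).

Lemma corner_affine (h : map_data) (t t' : U * U) (i : 'I_3) :
  corner i t = corner i t' -> corner i (affine_triple h t) = corner i (affine_triple h t').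
Proof.
elim/ord3P: i; rewrite /corner /=; [by move-> | by move-> | ].
by rewrite (addrACA (t.1 *m _)) (addrACA (t'.1 *m _)) -!mulmxDl => /oppr_inj->.
Qed.

(** For each linear part exactly one pair of translations sends [t] to [s]. *)
Lemma card_affine_triple (t : U * U) (s : V * V) :
  #|[set h | affine_triple h t == s]| = #|{: M}|.
Proof.
pose f (A : M) : map_data := (A, s.1 - t.1 *m A, s.2 - t.2 *m A).
have f_inj : injective f by move=> A B [].
rewrite -cardsT -(card_imset _ f_inj); apply: eq_card => h.
rewrite inE; apply/eqP/imsetP => [E|[A _ ->]]; last first.
  by rewrite /affine_triple /= !subrKC; case: s {f f_inj}.
exists h.1.1; rewrite ?inE // /f -E /affine_triple /=.
by rewrite [_ + h.1.2]addrC [_ + h.2]addrC !addrK; case: h {E} => [[]].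
Qed.

(** The matrices [B z] satisfy [r *m B z = z], so the translates of the fibre by them are pairwise
    disjoint. *)
Lemma card_mulmx_fiber (r : U) (y : V) : r != 0 ->
  (#|[set A : M | r *m A == y]| * #|{: V}| <= #|{: M}|)%N.
Proof.
move=> r0; have [j rj] : exists j, r 0 j != 0.
  by apply/existsP; rewrite -negb_forall; apply: contra r0 => /eqfunP r0; apply/eqP/rowP => j; rewrite mxE.
pose B (z : V) : M := \matrix_(i, l) ((i == j)%:R * (r 0 j)^-1 * z 0 l).
have rB z : r *m B z = z.
  apply/rowP => l; rewrite !mxE (bigD1 j) //= mxE eqxx mul1r mulrA divff // mul1r.
  by rewrite big1 ?addr0 // => i /negbTE ij; rewrite mxE ij !mul0r mulr0.
rewrite -[#|{: V}|]cardsT -cardsX.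
rewrite -(@card_in_imset _ _ (fun q : M * V => q.1 + B q.2)); first exact: max_card.
move=> [A z] [A' z']; rewrite !inE /= !andbT => /eqP rA /eqP rA' E.
have Ez : z = z'.
  by have := congr1 (mulmx r) E; rewrite !mulmxDr !rB rA rA' => /addrI.
by move: E; rewrite Ez => /addIr->.
Qed.

(** Subtracting the two conditions in an entry where [t] and [t'] differ prescribes the image of a
    nonzero vector under the linear part; the linear part then determines the translations. *)
Lemma card_affine_triple2 (t t' : U * U) (s s' : V * V) : t != t' ->
  (#|[set h | (affine_triple h t == s) && (affine_triple h t' == s')]| * #|{: V}| <= #|{: M}|)%N.
Proof.
move=> tt'.
suff [r [y r0 H]] : exists r : U, exists2 y : V, r != 0 & forall h : map_data,
    affine_triple h t == s -> affine_triple h t' == s' -> r *m h.1.1 = y.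
  apply: leq_trans (card_mulmx_fiber y r0); rewrite leq_mul2r; apply/orP; right.
  rewrite -(@card_in_imset _ _ (fun h : map_data => h.1.1)).
    apply/subset_leq_card/subsetP => B /imsetP[h + ->]; rewrite inE => /andP[h1 h2].
    by rewrite inE; apply/eqP/H.
  move=> [[A a] b] [[A' a'] b']; rewrite !inE /affine_triple /=.
  move=> /andP[/eqP<- _] /andP[/eqP E _] EA; move: E; rewrite EA.
  by move=> [/addrI-> /addrI->].
case: (eqVneq t.1 t'.1) => [E1|N1].
  exists (t.2 - t'.2), (s.2 - s'.2).
    by rewrite subr_eq0; apply: contra tt'; rewrite -pair_eqE /= E1 eqxx.
  by move=> h /eqP<- /eqP<-; rewrite /= mulmxBl opprD addrACA subrr addr0.
exists (t.1 - t'.1), (s.1 - s'.1); first by rewrite subr_eq0.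
by move=> h /eqP<- /eqP<-; rewrite /= mulmxBl opprD addrACA subrr addr0.
Qed.

Section Isolated.
Variables (X : 'I_3 -> {set V}) (h : map_data).

Definition isolated : {set U * U} := [set t | (affine_triple h t \in triangles X) &&
  [forall i, forall t', (t' != t) && (corner i t' == corner i t) ==>
     (affine_triple h t' \notin triangles X)]].

Lemma isolatedP (t t' : U * U) (i : 'I_3) : t \in isolated ->
  affine_triple h t' \in triangles X -> corner i t' = corner i t -> t' = t.
Proof.
rewrite inE => /andP[_ /forallP/(_ i)/forallP/(_ t') iso] good' /eqP same.
by move: iso; rewrite same good' andbT implybF negbK => /eqP.
Qed.

(** Suppose corners 0, 1, 2 of three isolated triples sum to zero. They form a triple whose image is
    again a triangle, because each of its corners comes from a triple that maps to a triangle;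
    isolation makes all four triples equal. Hence isolated triples are tricoloured sum-free. *)
Lemma card_isolated : (#|isolated| <= 3 * #|low_monomials p d|)%N.
Proof.
pose tr (i : 'I_#|isolated|) : U * U := enum_val i.
apply: (@tricoloured_sum_free_bound p d p_prime _ (fun i => corner 0 (tr i))
  (fun i => corner 1 (tr i)) (fun i => corner 2%:R (tr i))) => i j k.
apply/idP/andP => [/eqP sum0|[/eqP-> /eqP->]]; last by rewrite corner_sum.
pose t : U * U := (corner 0 (tr i), corner 1 (tr j)).
have t2 : corner 2%:R t = corner 2%:R (tr k).
  by apply/eqP; rewrite [corner _ t]/corner /= eq_sym -addr_eq0 addrC sum0.
have good l : affine_triple h (tr l) \in triangles X.
  by have := enum_valP l; rewrite inE => /andP[].
have good_t : affine_triple h t \in triangles X.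
  rewrite inE; apply/forallP; apply: ord3P.
  - rewrite (@corner_affine h t (tr i)) //; have := good i; rewrite inE.
    by move/forallP/(_ 0).
  - rewrite (@corner_affine h t (tr j)) //; have := good j; rewrite inE.
    by move/forallP/(_ 1).
  - rewrite (@corner_affine h t (tr k)) //; have := good k; rewrite inE.
    by move/forallP/(_ 2%:R).
have ti : t = tr i by apply: (isolatedP (i := 0)) => //; apply: enum_valP.
have tj : t = tr j by apply: (isolatedP (i := 1)) => //; apply: enum_valP.
have tk : t = tr k by apply: (isolatedP (i := 2%:R)) => //; apply: enum_valP.
split; apply/eqP/enum_val_inj; [exact: etrans (esym ti) tj | exact: etrans (esym tj) tk].
Qed.

(** A triple that maps to a triangle without being isolated is paid for by a conflicting pair. *)
Lemma card_good_le :
  (\sum_t (affine_triple h t \in triangles X) <= #|isolated| +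
   \sum_t \sum_i \sum_(t' | (t' != t) && (corner i t' == corner i t))
     ((affine_triple h t \in triangles X) && (affine_triple h t' \in triangles X)))%N.
Proof.
have -> : #|isolated| = (\sum_t (t \in isolated))%N.
  by rewrite -sum1_card big_mkcond; apply: eq_bigr => t _; case: (t \in _).
rewrite -big_split leq_sum //= => t _.
case: (boolP (affine_triple h t \in triangles X)) => //= good_t.
rewrite inE good_t /=; case: (boolP [forall i, _]) => //=; rewrite negb_forall => /existsP[i].
rewrite negb_forall => /existsP[t']; rewrite negb_imply negbK => /andP[c good'].
by rewrite (bigD1 i) //= (bigD1 t') //= good'.
Qed.
End Isolated.

(** Write [T] for the number of triangles, [L] for that of low monomials and [N = p^n]. Summed over
    all maps, [p^(2d) T |M|] triples land on triangles, and at most [3 p^(3d) T Delta |M| / N]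
    conflicts occur, at most half as many by the second hypothesis. The rest is isolated, at most
    [3 L] per map. *)
Lemma sampling_bound (X : 'I_3 -> {set V}) (Delta : nat) :
  (forall i x, degree X i x <= Delta)%N -> (6 * expn p d * Delta <= expn p n)%N ->
  (expn p d ^ 2 * #|triangles X| <= 6 * #|low_monomials p d| * expn p n ^ 2)%N.
Proof.
move=> degX small.
set T := #|triangles X|; set L := #|low_monomials p d|.
have cardU : #|{: U}| = expn p d by rewrite card_mx mul1n card_Fp.
have cardV : #|{: V}| = expn p n by rewrite card_mx mul1n card_Fp.
have M_gt0 : (0 < #|{: M}|)%N by rewrite card_mx card_Fp // expn_gt0 prime_gt0.
have cardH : #|{: map_data}| = (#|{: M}| * expn p n ^ 2)%N.
  by rewrite !card_prod cardV mulnA.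
have good_sum : (\sum_(h : map_data) \sum_t (affine_triple h t \in triangles X)
    = expn p d ^ 2 * (T * #|{: M}|))%N.
  rewrite exchange_big /= (eq_bigr (fun=> T * #|{: M}|)%N) => [|t _].
    by rewrite sum_nat_const card_prod cardU.
  rewrite -sum_nat_const (eq_bigr (fun h => \sum_(s in triangles X) (affine_triple h t == s)))%N.
    rewrite exchange_big; apply: eq_bigr => s _ /=.
    by rewrite -(card_affine_triple t s) -sum1dep_card [RHS]big_mkcond.
  move=> h _; case: (boolP (_ \in _)) => good.
    rewrite (bigD1 (affine_triple h t)) //= eqxx big1 // => s /andP[_ /negbTE].
    by rewrite eq_sym => ->.
  by rewrite big1 // => s sT; case: eqP good => // ->; rewrite sT.
(* Images of triples sharing corner [i] share it too, so only the at most [T * Delta] pairs of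
   triangles with a common corner matter. *)
have bad_pair (t t' : U * U) i : t' != t -> corner i t' = corner i t ->
    (\sum_(h : map_data) ((affine_triple h t \in triangles X) && (affine_triple h t' \in triangles X))
       * expn p n <= T * Delta * #|{: M}|)%N.
  move=> tt' ct; rewrite -big_distrl /=.
  apply: (@leq_trans (\sum_(s in triangles X) \sum_(s' in [set s' in triangles X | corner i s' == corner i s])
     #|[set h | (affine_triple h t == s) && (affine_triple h t' == s')]| * expn p n)).
    under [leqRHS]eq_bigr => s _ do rewrite -big_distrl /=.
    rewrite -big_distrl /= leq_mul2r; apply/orP; right.
    under [X in (_ <= X)%N]eq_bigr => s _.
      under eq_bigr => s' _ do rewrite -sum1dep_card big_mkcond /=.
      rewrite exchange_big /=; over.
    rewrite exchange_big /= leq_sum // => h _.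
    case: (boolP (_ \in _)) => //= good; case: (boolP (_ \in _)) => //= good'.
    rewrite (bigD1 (affine_triple h t)) //= (bigD1 (affine_triple h t')) ?eqxx //=.
    by rewrite inE good' (@corner_affine h t' t) ?eqxx.
  apply: (@leq_trans (\sum_(s in triangles X) \sum_(s' in [set s' in triangles X | corner i s' == corner i s]) #|{: M}|)).
    apply: leq_sum => s _; apply: leq_sum => s' _.
    by rewrite -cardV; apply: card_affine_triple2; rewrite eq_sym.
  under eq_bigr => s _ do rewrite sum_nat_const.
  by rewrite -big_distrl /= leq_mul2r same_corner_pairs ?orbT.
have bad_sum : ((\sum_(h : map_data) \sum_t \sum_i \sum_(t' | (t' != t) && (corner i t' == corner i t))
     ((affine_triple h t \in triangles X) && (affine_triple h t' \in triangles X))) * expn p n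
     <= expn p d ^ 2 * (3 * (expn p d * (T * Delta * #|{: M}|))))%N.
  rewrite exchange_big /=.
  have -> : (expn p d ^ 2 * (3 * (expn p d * (T * Delta * #|{: M}|))) =
      \sum_(t : U * U) \sum_(i < 3) (expn p d * (T * Delta * #|{: M}|)))%N.
    by rewrite !sum_nat_const card_prod cardU card_ord.
  rewrite big_distrl /= leq_sum // => t _; rewrite exchange_big /= big_distrl /= leq_sum // => i _.
  rewrite exchange_big /= big_distrl /=.
  apply: (@leq_trans (\sum_(t' | (t' != t) && (corner i t' == corner i t)) (T * Delta * #|{: M}|))%N).
    apply: leq_sum => t' /andP[tt' /eqP ct].
    by rewrite big_distrl /=; apply: bad_pair ct.
  rewrite sum_nat_const leq_mul2r; apply/orP; right.
  rewrite -cardU; apply: leq_trans (card_same_corner i t).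
  by apply/subset_leq_card/subsetP => t'; rewrite !inE => /andP[].
have iso_sum : (\sum_(h : map_data) #|isolated X h| <= #|{: M}| * expn p n ^ 2 * (3 * L))%N.
  by rewrite -cardH -sum_nat_const leq_sum // => h _; apply: card_isolated.
have total : (expn p d ^ 2 * (T * #|{: M}|) * expn p n <=
   #|{: M}| * expn p n ^ 2 * (3 * L) * expn p n + expn p d ^ 2 * (3 * (expn p d * (T * Delta * #|{: M}|))))%N.
  apply: leq_trans (leq_add (leq_mul iso_sum (leqnn _)) bad_sum).
  rewrite -good_sum -mulnDl leq_mul2r; apply/orP; right.
  by rewrite -big_split /= leq_sum // => h _; apply: card_good_le.
have N_gt0 : (0 < expn p n)%N by rewrite expn_gt0 prime_gt0.
rewrite -(leq_pmul2r M_gt0) -(leq_pmul2r N_gt0).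
move: small total; move: #|{: M}| (expn p d) (expn p n) => m g N small total.
have : (g ^ 2 * T * m * (6 * g * Delta) <= g ^ 2 * T * m * N)%N by rewrite leq_mul2l small orbT.
move: total; rewrite -!mulnn. lia.
Qed.

End Sampling.

(** * Deleting elements of high degree *)

Section Pruning.
Variable V : finZmodType.

Definition triangle_matching (X : 'I_3 -> {set V}) (S : {set V * V}) : Prop :=
  S \subset triangles X /\ forall i, {in S &, injective (corner i)}.

Lemma triangles_sub (X X' : 'I_3 -> {set V}) :
  (forall i, X' i \subset X i) -> triangles X' \subset triangles X.
Proof.
move=> sub; apply/subsetP => t; rewrite !inE => /forallP Xt; apply/forallP => i.
exact: subsetP (sub i) _ (Xt i).
Qed.

(** In each part, the number of elements of degree above [h], times [h], is at most the number of
    triangles. Each such element lies on at most one triple of the matching, so deleting them all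
    costs few triples. *)
Lemma prune_high_degree (X : 'I_3 -> {set V}) (S : {set V * V}) (h : nat) :
  triangle_matching X S -> exists X' S',
  [/\ triangle_matching X' S', forall i x, (degree X' i x <= h)%nat &
      (#|S| * h <= #|S'| * h + 3 * #|triangles X|)%nat].
Proof.
move=> [SX Sinj].
pose H i := [set x | h < degree X i x].
pose X' i := X i :\: H i.
have X'X : forall i, X' i \subset X i by move=> i; apply: subsetDl.
pose S' := [set t in S | [forall i, corner i t \notin H i]].
have H_small i : (#|H i| * h <= #|triangles X|)%nat.
  apply: (@leq_trans (\sum_(x in H i) degree X i x)).
    by rewrite -sum_nat_const; apply: leq_sum => x; rewrite inE => /ltnW.
  rewrite -sum1_card (partition_big (corner i) predT) //=.
  rewrite [leqRHS](bigID (fun x => x \in H i)) /=; apply: leq_trans (leq_addr _ _).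
  by apply: leq_sum => x _; rewrite /degree -sum1_card; apply: eq_leq; apply: eq_bigl => t; rewrite inE.
exists X', S'; split.
- split; last by move=> i t t'; rewrite !inE => /andP[tS _] /andP[t'S _]; apply: Sinj.
  apply/subsetP => t; rewrite !inE => /andP[/(subsetP SX) + /forallP nH].
  by rewrite inE => /forallP Xt; apply/forallP => i; rewrite inE nH Xt.
- move=> i x; case: (boolP (x \in H i)) => xH.
    rewrite /degree (_ : [set _ in _ | _] = set0) ?cards0 //.
    apply/setP => t; rewrite !inE; apply/negP => /andP[/forallP/(_ i) + /eqP E].
    by rewrite inE E xH.
  apply: (@leq_trans (degree X i x)); last by move: xH; rewrite inE -leqNgt.
  apply: subset_leq_card; apply/subsetP => t; have := subsetP (triangles_sub X'X) t.
  by rewrite !inE => sub /andP[/sub-> ->].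
have S_le : (#|S| <= #|S'| + \sum_(i < 3) #|H i|)%nat.
  have H_image i : (\sum_(t in S) (corner i t \in H i) <= #|H i|)%nat.
    rewrite (_ : (\sum_(t in S) _)%nat = #|[set t in S | corner i t \in H i]|).
      rewrite -(@card_in_imset _ _ (corner i)).
        by apply: subset_leq_card; apply/subsetP => x /imsetP[t + ->]; rewrite inE => /andP[].
      by move=> t t'; rewrite !inE => /andP[tS _] /andP[t'S _]; apply: Sinj.
    rewrite -sum1_card [RHS](eq_bigl (fun t => (t \in S) && (corner i t \in H i))) => [|t]; last by rewrite inE.
    by rewrite [RHS]big_mkcondr; apply: eq_bigr => t _; case: ifP.
  apply: leq_trans (_ : #|S'| + \sum_(i < 3) \sum_(t in S) (corner i t \in H i) <= _)%nat; last first.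
    by rewrite leq_add2l leq_sum.
  rewrite exchange_big /= -!sum1_card.
  rewrite [X in (_ <= X + _)%nat](eq_bigl (fun t => (t \in S) && [forall i, corner i t \notin H i])) => [|t]; last by rewrite inE.
  rewrite [X in (_ <= X + _)%nat]big_mkcondr -big_split /= leq_sum // => t tS.
  case: ifP => // /negbT; rewrite negb_forall => /existsP[i]; rewrite negbK => tH.
  by rewrite (bigD1 i) //= tH.
have sumH : (\sum_(i < 3) #|H i| * h <= 3 * #|triangles X|)%nat.
  by apply: leq_trans (leq_sum _ (fun i _ => H_small i)) _; rewrite sum_nat_const card_ord.
rewrite -big_distrl /= in sumH.
by apply: leq_trans (leq_mul S_le (leqnn h)) _; rewrite mulnDl leq_add2l.
Qed.
End Pruning.

(** * Cycles with distinct partial sums *)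

Section Resampling.
Local Open Scope ring_scope.
Variables (V : finZmodType) (I : finType).

(* The indices a and d carry no marginal condition: resampling with f2 and f3 exchanged
   only uses the marginals of b and c. *)
Definition cycle_weight (f1 f2 f3 f4 : I -> V) (kappa w : rat)
    (mu : I -> I -> I -> I -> rat) : Prop :=
  [/\ forall a b c d, 0 <= mu a b c d /\
        (mu a b c d != 0 -> f1 a + f2 b + (f3 c + f4 d) = 0),
      forall b, \sum_a \sum_c \sum_d mu a b c d <= 1,
      forall c, \sum_a \sum_b \sum_d mu a b c d <= 1,
      forall a b, \sum_c \sum_d mu a b c d <= kappa &
      w <= \sum_a \sum_b \sum_c \sum_d mu a b c d].

(** Given the sum [y], the pairs [(a, b)] and [(c, d)] are redrawn independently. Fixing [a], [c],
    [d] leaves at most one [b], and its weight is [m34 c d] times [m12 a b / my y], at most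
    [kappa / 2] once sums of weight below 2 are dropped. Each dropped sum costs at most 2, and sums
    outside [F] carry no weight. *)
Lemma resample (f1 f2 f3 f4 : I -> V) (F : {set V}) (kappa w : rat) mu :
  injective f2 -> 0 <= kappa ->
  (forall a b c d, f1 a + f2 b + (f3 c + f4 d) = 0 -> f1 a + f2 b \in F) ->
  cycle_weight f1 f2 f3 f4 kappa w mu ->
  exists nu, cycle_weight f1 f3 f2 f4 (kappa / 2%:R) (w - (2 * #|F|)%:R) nu.
Proof.
move=> f2_inj kappa_ge0 sumF [mu_ok mu_b mu_c mu_ab mu_w].
have mu_ge0 a b c d : 0 <= mu a b c d by case: (mu_ok a b c d).
have eqW (x y : rat) : x = y -> x <= y by move=> ->.
have rot (G : I -> I -> I -> rat) :
    \sum_a \sum_b \sum_d G a b d = \sum_d \sum_a \sum_b G a b d.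
  by under eq_bigr => a _ do rewrite exchange_big /=; rewrite exchange_big.
have mu_supp a b c d := (mu_ok a b c d).2.
pose m12 a b := \sum_c \sum_d mu a b c d.
pose m34 c d := \sum_a \sum_b mu a b c d.
pose my y := \sum_a \sum_(b | f1 a + f2 b == y) m12 a b.
have m12_ge0 a b : 0 <= m12 a b by apply: sumr_ge0 => c _; apply: sumr_ge0.
have m34_ge0 c d : 0 <= m34 c d by apply: sumr_ge0 => a _; apply: sumr_ge0.
(* On the support of [mu] the two halves have opposite sums, so the weight of [y] can be read off
   either half. *)
have my34 y : my y = \sum_c \sum_(d | f3 c + f4 d == - y) m34 c d.
  pose g a b c d := (f1 a + f2 b == y)%:R * mu a b c d.
  transitivity (\sum_a \sum_b \sum_c \sum_d g a b c d).
    apply: eq_bigr => a _; rewrite big_mkcond /=; apply: eq_bigr => b _.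
    rewrite /g; case: ifP => _; last by rewrite big1 // => c _; rewrite big1 // => d _; rewrite mul0r.
    by apply: eq_bigr => c _; apply: eq_bigr => d _; rewrite mul1r.
  transitivity (\sum_c \sum_d \sum_a \sum_b g a b c d); last first.
    apply: eq_bigr => c _; rewrite [RHS]big_mkcond /=; apply: eq_bigr => d _.
    case: ifP => cd.
      apply: eq_bigr => a _; apply: eq_bigr => b _; rewrite /g.
      have [->|/mu_supp E] := eqVneq (mu a b c d) 0; first by rewrite mulr0.
      suff -> : f1 a + f2 b == y by rewrite mul1r.
      by move: E; rewrite (eqP cd) => /subr0_eq ->.
    apply: big1 => a _; apply: big1 => b _; rewrite /g.
    have [->|/mu_supp E] := eqVneq (mu a b c d) 0; first by rewrite mulr0.
    case: eqP => [Ey|]; last by rewrite mul0r.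
    by move/eqP: E cd; rewrite Ey addrC addr_eq0 => ->.
  under eq_bigr => a _ do rewrite exchange_big /=.
  rewrite exchange_big; apply: eq_bigr => c _ /=.
  under eq_bigr => a _ do rewrite exchange_big /=.
  by rewrite exchange_big.
pose ok a b := 2%:R <= my (f1 a + f2 b).
(* Under [nu], (a, b) and (c, d) are independent given the common sum f1 a + f2 b. *)
pose nu a b c d := if (f1 a + f2 b + (f3 c + f4 d) == 0) && ok a b
   then m12 a b * m34 c d / my (f1 a + f2 b) else 0.
have nu_ge0 a b c d : 0 <= nu a b c d.
  rewrite /nu; case: ifP => // /andP[_ okab].
  by rewrite divr_ge0 ?mulr_ge0 // (le_trans _ okab).
(* Resampling preserves the pair weights on the sums that are kept, so total weight is lost only
   through dropped sums. *)
have nu12 a b : \sum_c \sum_d nu a b c d = if ok a b then m12 a b else 0.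
  case: ifP => okab; last first.
    by apply: big1 => c _; apply: big1 => d _; rewrite /nu okab andbF.
  have my0 : my (f1 a + f2 b) != 0 by rewrite gt_eqF // (lt_le_trans _ okab).
  transitivity (m12 a b / my (f1 a + f2 b) * my (f1 a + f2 b)); last by rewrite divfK.
  rewrite {2}my34 mulr_sumr; apply: eq_bigr => c _.
  rewrite mulr_sumr [RHS]big_mkcond /=; apply: eq_bigr => d _.
  by rewrite /nu okab andbT addrC addr_eq0; case: ifP => // _; rewrite mulrAC.
have nu34 c d : \sum_a \sum_b nu a b c d <= m34 c d.
  have [my_ok|my_nok] := boolP (2%:R <= my (- (f3 c + f4 d))); last first.
    rewrite big1 // => a _; rewrite big1 // => b _; rewrite /nu addr_eq0.
    by case: eqP => // E; rewrite /ok E (negbTE my_nok).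
  have my0 : my (- (f3 c + f4 d)) != 0 by rewrite gt_eqF // (lt_le_trans _ my_ok).
  apply: eqW; transitivity (m34 c d / my (- (f3 c + f4 d)) * my (- (f3 c + f4 d))); last by rewrite divfK.
  rewrite {2}/my mulr_sumr; apply: eq_bigr => a _.
  rewrite mulr_sumr [RHS]big_mkcond /=; apply: eq_bigr => b _.
  rewrite /nu addr_eq0 /ok; case: eqP => //= ->; rewrite my_ok.
  by rewrite [RHS]mulrAC [m34 c d * _]mulrC.
exists (fun a c b d => nu a b c d); split=> //.
- move=> a c b d; split=> //; rewrite /nu; case: ifP => [/andP[/eqP E _] _|_]; last by rewrite eqxx.
  by rewrite addrACA.
- move=> c; apply: le_trans (mu_c c).
  rewrite (rot (fun a b d => nu a b c d)) (rot (fun a b d => mu a b c d)).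
  by apply: ler_sum => d _; apply: nu34.
- move=> b; apply: le_trans (mu_b b).
  apply: ler_sum => a _; rewrite nu12; case: ifP => // _; exact: m12_ge0.
- move=> a c.
  apply: (@le_trans _ _ (\sum_d kappa / 2%:R * m34 c d)); last first.
    rewrite -mulr_sumr -[leRHS]mulr1 ler_wpM2l ?divr_ge0 //.
    by apply: le_trans (mu_c c); rewrite (rot (fun a b d => mu a b c d)).
  rewrite exchange_big; apply: ler_sum => d _ /=.
  have bound b : nu a b c d <= kappa / 2%:R * m34 c d.
    rewrite /nu; case: ifP => [/andP[_ okab]|_]; last by rewrite mulr_ge0 // divr_ge0.
    rewrite mulrAC ler_wpM2r // ler_pM ?invr_ge0 ?(le_trans _ okab) //; first exact: mu_ab.
    by rewrite lef_pV2 ?posrE // (lt_le_trans _ okab).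
  case: (pickP (fun b => f1 a + f2 b + (f3 c + f4 d) == 0)) => [b0 b0P|none]; last first.
    rewrite big1 => [|b _]; last by rewrite /nu none.
    by rewrite mulr_ge0 // divr_ge0.
  rewrite (bigD1 b0) //= big1 ?addr0 // => b bb0; rewrite /nu.
  case: eqP => // E; case/eqP: bb0; apply: f2_inj.
  by move: E (eqP b0P) => <- /addIr/addrI.
- have lost : \sum_a \sum_(b | ~~ ok a b) m12 a b <= (2 * #|F|)%:R.
    apply: (@le_trans _ _ (\sum_(y in F) 2%:R)); last by rewrite sumr_const -[leLHS]mulrnA.
    apply: (@le_trans _ _ (\sum_(y in F) \sum_a \sum_b
        (if (f1 a + f2 b == y) && ~~ ok a b then m12 a b else 0))).
      rewrite [leRHS]exchange_big /=; apply: ler_sum => a _.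
      rewrite [leRHS]exchange_big /= [leLHS]big_mkcond.
      apply: ler_sum => b _; case: ifP => nok; last first.
        by apply: sumr_ge0 => y _; rewrite andbF.
      have [yF|yF] := boolP (f1 a + f2 b \in F).
        rewrite (bigD1 (f1 a + f2 b)) //= eqxx /= lerDl; apply: sumr_ge0 => y _.
        by case: ifP.
      rewrite /m12 big1 ?sumr_ge0 // => [y _|c _]; first by case: ifP => // _; apply: m12_ge0.
      apply: big1 => d _; apply/eqP; apply: contraNT yF => /mu_supp; exact: sumF.
    apply: ler_sum => y _.
    have [my_ok|my_nok] := boolP (2%:R <= my y).
      rewrite big1 // => a _; rewrite big1 // => b _.
      by case: eqP => //= E; rewrite /ok E my_ok.
    apply: le_trans (ltW (_ : my y < _)); last by rewrite ltNge.
    apply: ler_sum => a _; rewrite [leRHS]big_mkcond; apply: ler_sum => b _ /=.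
    by case: eqP => //= _; case: ifP.
  rewrite lerBlDr; apply: le_trans mu_w _.
  apply: le_trans (lerD (lexx _) lost); rewrite -big_split /=; apply: ler_sum => a _.
  rewrite [leLHS](bigID (ok a)) /= lerD2r [leRHS]exchange_big /= [leLHS]big_mkcond /=.
  by apply: ler_sum => b _; rewrite nu12.
Qed.

(** Each round halves the cap on pair weights and costs at most [2 * D]. Since a round exchanges
    [f2] and [f3], the induction hypothesis is used with the roles exchanged. *)
Lemma iterated_resampling (s D : nat) (f1 f2 f3 f4 : I -> V) (F1 F2 : {set V}) :
  injective f2 -> injective f3 -> (#|F1| <= D)%N -> (#|F2| <= D)%N ->
  (forall i, f1 i + f2 i + (f3 i + f4 i) = 0) ->
  (forall a b c d, f1 a + f2 b + (f3 c + f4 d) = 0 ->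
     (f1 a + f2 b \in F1) && (f1 a + f3 c \in F2)) ->
  exists mu, cycle_weight f1 f2 f3 f4 (2%:R ^- s) (#|I|%:R - (2 * D * s)%:R) mu.
Proof.
move=> + + + + sum0.
elim: s f2 f3 F1 F2 sum0 => [|s IHs] f2 f3 F1 F2 sum0 inj2 inj3 F1D F2D sumF.
  exists (fun a b c d => ((a == b) && (c == d) && (b == c))%:R).
  have sum1 (a0 : I) : \sum_a (a == a0)%:R = 1 :> rat.
    by rewrite (bigD1 a0) //= eqxx big1 ?addr0 // => a /negbTE->.
  have sum1' (a0 : I) : \sum_a (a0 == a)%:R = 1 :> rat.
    by rewrite -[RHS](sum1 a0); apply: eq_bigr => a _; rewrite eq_sym.
  have sum_d (a b c : I) : \sum_d ((a == b) && (c == d) && (b == c))%:R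
      = ((a == b) && (b == c))%:R :> rat.
    case: (a == b) => /=; last by rewrite big1.
    case: (b == c); last by rewrite big1 // => d; rewrite andbF.
    by rewrite -[RHS](sum1' c); apply: eq_bigr => d _; rewrite andbT.
  have sum_cd (a b : I) : \sum_c \sum_d ((a == b) && (c == d) && (b == c))%:R
      = (a == b)%:R :> rat.
    under eq_bigr do rewrite sum_d.
    by case: (a == b) => /=; [exact: sum1' | rewrite big1].
  split=> [a b c d|b|c|a b|].
  - split=> //; rewrite pnatr_eq0 eqb0 negbK => /andP[/andP[/eqP-> /eqP->] /eqP->].
    exact: sum0.
  - by under eq_bigr do rewrite sum_cd; rewrite sum1.
  - under eq_bigr => a _ do under eq_bigr do rewrite sum_d.
    rewrite exchange_big /=; under eq_bigr => b _.
      rewrite (eq_bigr (fun a => (b == c)%:R * (a == b)%:R)) => [|a _]; last first.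
        by rewrite -natrM mulnb andbC.
      rewrite -mulr_sumr sum1 mulr1; over.
    by rewrite sum1.
  - by rewrite sum_cd expr0 invr1 lern1 leq_b1.
  - under eq_bigr => a _ do under eq_bigr do rewrite sum_cd.
    under eq_bigr do rewrite sum1'.
    by rewrite muln0 subr0 sumr_const.
have [i|a b c d E|mu mu_w] := IHs f3 f2 F2 F1 _ inj3 inj2 F2D F1D.
- by rewrite addrACA.
- by rewrite andbC; exact: (sumF a c b d (etrans (addrACA _ _ _ _) E)).
have [||nu] := resample (F := F2) inj3 _ _ mu_w.
- by rewrite invr_ge0 exprn_ge0.
- by move=> a b c d E; have /andP[] := sumF a c b d (etrans (addrACA _ _ _ _) E).
case=> nu1 nu2 nu3 nu4 nu5; exists nu; split=> //.
  by move=> a b; apply: le_trans (nu4 a b) _; rewrite exprSr invfM.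
apply: le_trans nu5; rewrite -addrA lerD2l -opprD -natrD lerN2 ler_nat.
by move: F2D; nia.
Qed.

(** After [s] rounds at least half of the weight [#|I|] survives, spread over [#|I|^2] pairs of
    weight at most [2^-s]. *)
Lemma few_sums_bound (s D : nat) (f1 f2 f3 f4 : I -> V) (F1 F2 : {set V}) :
  injective f2 -> injective f3 -> (#|F1| <= D)%N -> (#|F2| <= D)%N ->
  (forall i, f1 i + f2 i + (f3 i + f4 i) = 0) ->
  (forall a b c d, f1 a + f2 b + (f3 c + f4 d) = 0 ->
     (f1 a + f2 b \in F1) && (f1 a + f3 c \in F2)) ->
  (0 < #|I|)%N -> (4 * D * s <= #|I|)%N -> (expn 2 s <= 2 * #|I|)%N.
Proof.
move=> inj2 inj3 F1D F2D sum0 sumF I_gt0 small.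
have [mu [_ _ _ kap tot]] := iterated_resampling s inj2 inj3 F1D F2D sum0 sumF.
have tot_le : \sum_a \sum_b \sum_c \sum_d mu a b c d <= #|I|%:R ^+ 2 * 2%:R ^- s.
  apply: (@le_trans _ _ (\sum_(a : I) \sum_(b : I) 2%:R ^- s)).
    by apply: ler_sum => a _; apply: ler_sum.
  by rewrite !sumr_const -mulrnA -[leLHS]mulr_natl natrM -expr2.
have := le_trans tot tot_le; rewrite ler_pdivlMr ?exprn_gt0 // -natrX.
have half : #|I|%:R / 2%:R <= #|I|%:R - (2 * D * s)%:R :> rat.
  by rewrite ler_pdivrMr // mulrBl lerBrDr -!natrM -natrD ler_nat; lia.
move=> le1; have : #|I|%:R / 2%:R * (expn 2 s)%:R <= #|I|%:R ^+ 2 :> rat.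
  by apply: le_trans le1; rewrite ler_wpM2r.
rewrite mulrAC ler_pdivrMr // -natrM -natrX -natrM ler_nat -mulnn -mulnA leq_pmul2l //.
by rewrite mulnC.
Qed.

End Resampling.

(** * Maximal disjoint families and the selection of distinct sums *)

Lemma maximal_independent (T : finType) (r : rel T) (P : pred T) :
  reflexive r -> symmetric r -> exists C : {set T},
  [/\ {in C, forall x, P x}, {in C &, forall x y, r x y -> x = y} &
     forall x, P x -> exists2 y, y \in C & r x y].
Proof.
move=> r_refl r_sym.
pose ind (C : {set T}) := [forall x in C, P x && [forall y in C, r x y ==> (x == y)]].
have ind0 : ind set0 by apply/forall_inP => x; rewrite inE.
have [C maxC _] := maxset_exists ind0.
have indC := maxsetp maxC; exists C.
have indP (x y : T) : x \in C -> y \in C -> r x y -> x = y.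
  move=> xC yC rxy; move/forall_inP: indC => /(_ x xC)/andP[_ /forall_inP/(_ y yC)].
  by rewrite rxy => /eqP.
split=> // [x xC|x Px]; first by move/forall_inP: indC => /(_ x xC)/andP[].
apply/exists_inP; apply: contraT; rewrite negb_exists_in => /forall_inP noC.
have xC : x \notin C by apply: contraL (r_refl x) => /noC.
case/negP: xC; rewrite -(maxsetsup maxC (B := x |: C)) ?setU11 ?subsetUr //.
apply/forall_inP => y /setU1P[->|yC]; apply/andP; split=> //.
- by apply/forall_inP => z /setU1P[->|/noC/negbTE->//]; rewrite eqxx implybT.
- by move/forall_inP: indC => /(_ y yC)/andP[].
- apply/forall_inP => z /setU1P[->|zC]; first by rewrite r_sym (negbTE (noC y yC)).
  by apply/implyP => /(indP _ _ yC zC) ->.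
Qed.

Section Selection.
Local Open Scope ring_scope.
Variables (V : finZmodType) (I : finType) (f1 f2 f3 f4 : I -> V).
Implicit Types x : I * I * (I * I).

Definition sums_to_zero x := f1 x.1.1 + f2 x.1.2 + (f3 x.2.1 + f4 x.2.2) == 0.

(** The four entries index terms taken from possibly different cycles of the original matching. *)
Definition disjoint_family (C : {set I * I * (I * I)}) : Prop :=
  [/\ {in C, forall x, sums_to_zero x},
      {in C &, injective (fun x => x.1.1)}, {in C &, injective (fun x => x.1.2)},
      {in C &, injective (fun x => x.2.1)} & {in C &, injective (fun x => x.2.2)}].

Definition index_support (C : {set I * I * (I * I)}) : {set I} :=
  [set x.1.1 | x in C] :|: [set x.1.2 | x in C] :|: ([set x.2.1 | x in C] :|: [set x.2.2 | x in C]).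

Lemma card_index_support C : (#|index_support C| <= 4 * #|C|)%N.
Proof.
have U (A B : {set I}) a b : (#|A| <= a -> #|B| <= b -> #|A :|: B| <= a + b)%N.
  by move=> ha hb; apply: leq_trans (leq_card_setU A B) (leq_add ha hb).
rewrite !mulSn mul0n addn0 addnA; apply: (U); apply: (U); exact: leq_imset_card.
Qed.

(** Two quadruples conflict if they share an index in the same position or have equal [y]. By
    maximality, a zero-sum quadruple with a new [y] conflicts through an index. *)
Lemma maximal_disjoint_family (y : I * I * (I * I) -> V) : exists C,
  [/\ disjoint_family C, {in C &, injective y} &
   forall x, sums_to_zero x -> y x \notin [set y x' | x' in C] ->
     exists2 i, i \in index_support C & i \in [:: x.1.1; x.1.2; x.2.1; x.2.2]].
Proof.
pose r x x' := [|| x.1.1 == x'.1.1, x.1.2 == x'.1.2, x.2.1 == x'.2.1, x.2.2 == x'.2.2 | y x == y x'].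
have r_refl : reflexive r by move=> x; rewrite /r eqxx.
have r_sym : symmetric r.
  by move=> x x'; rewrite /r (eq_sym x.1.1) (eq_sym x.1.2) (eq_sym x.2.1) (eq_sym x.2.2) (eq_sym (y x)).
have [C [CP Cind Cmax]] := maximal_independent sums_to_zero r_refl r_sym.
exists C; split.
- split=> // x x' xC x'C E; apply: Cind => //; rewrite /r E eqxx ?orbT //.
- by move=> x x' xC x'C E; apply: Cind => //; rewrite /r E eqxx !orbT.
move=> x /Cmax[x' x'C /or4P[/eqP E|/eqP E|/eqP E|/orP[/eqP E|/eqP E]]] yC.
- by exists x.1.1; [rewrite E /index_support !inE (imset_f (fun x => x.1.1) x'C) ?orbT | rewrite !inE eqxx ?orbT].
- by exists x.1.2; [rewrite E /index_support !inE (imset_f (fun x => x.1.2) x'C) ?orbT | rewrite !inE eqxx ?orbT].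
- by exists x.2.1; [rewrite E /index_support !inE (imset_f (fun x => x.2.1) x'C) ?orbT | rewrite !inE eqxx ?orbT].
- by exists x.2.2; [rewrite E /index_support !inE (imset_f (fun x => x.2.2) x'C) ?orbT | rewrite !inE eqxx ?orbT].
- by case/negP: yC; rewrite E; apply: imset_f.
Qed.

(** If the maximal families for both kinds of sum are small, remove every index they use. On the
    remaining indices each zero-sum quadruple has both sums among the few already taken, against
    [few_sums_bound]. *)
Lemma distinct_sum_selection (s : nat) : injective f2 -> injective f3 ->
  (forall i, f1 i + f2 i + (f3 i + f4 i) = 0) -> (2 * #|I| < expn 2 s)%N ->
  exists C, [/\ disjoint_family C,
    {in C &, injective (fun x => f1 x.1.1 + f2 x.1.2)} \/
    {in C &, injective (fun x => f1 x.1.1 + f3 x.2.1)} &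
    (#|I| <= #|C| * (12 * s))%N].
Proof.
move=> inj2 inj3 sum0 s_big.
have [C [Cdis Cy Cmax]] := maximal_disjoint_family (fun x => f1 x.1.1 + f2 x.1.2).
have [C' [C'dis C'y C'max]] := maximal_disjoint_family (fun x => f1 x.1.1 + f3 x.2.1).
have [C_big|C_small] := leqP #|I| (#|C| * (12 * s)); first by exists C; split=> //; left.
have [C'_big|C'_small] := leqP #|I| (#|C'| * (12 * s)); first by exists C'; split=> //; right.
pose D := maxn #|C| #|C'|.
pose J := {i : I | i \notin index_support C :|: index_support C'}.
have s_gt0 : (0 < s)%N.
  by case: (posnP s) s_big C_small => [->|//]; rewrite expn0 !muln0; lia.
have D_small : (D * (12 * s) < #|I|)%N by rewrite /D /maxn; case: ifP.
have D1 : (#|C| <= D)%N by rewrite leq_maxl.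
have D2 : (#|C'| <= D)%N by rewrite leq_maxr.
(* Each family uses at most [4 * D] indices. The constant 12 comes from
   [8 * D + 4 * D * s <= 12 * D * s]. *)
have cardJ : (#|I| - 8 * D <= #|{: J}|)%N.
  rewrite card_sig; rewrite leq_subLR -(cardC (mem (index_support C :|: index_support C'))).
  rewrite leq_add //.
    apply: leq_trans (leq_card_setU _ _) _.
    by have := card_index_support C; have := card_index_support C'; lia.
have J_le : (#|{: J}| <= #|I|)%N by rewrite card_sig max_card.
have := @few_sums_bound V J s D (f1 \o val) (f2 \o val) (f3 \o val) (f4 \o val)
  [set f1 x.1.1 + f2 x.1.2 | x in C] [set f1 x.1.1 + f3 x.2.1 | x in C'].
have F1D : (#|[set (f1 x.1.1 + f2 x.1.2)%R | x in C]| <= D)%N.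
  exact: leq_trans (leq_imset_card _ _) D1.
have F2D : (#|[set (f1 x.1.1 + f3 x.2.1)%R | x in C']| <= D)%N.
  exact: leq_trans (leq_imset_card _ _) D2.
have DsJ : (8 * D + 4 * D * s <= D * (12 * s))%N by nia.
have aux : (0 < #|{: J}|)%N /\ (4 * D * s <= #|{: J}|)%N by split; lia.
move/(_ (inj_comp inj2 val_inj) (inj_comp inj3 val_inj) F1D F2D) => few.
suff : (expn 2 s <= 2 * #|{: J}|)%N by move=> few'; exfalso; lia.
apply: few.
- by move=> i /=.
- move=> a b c d /= E.
  pose x := (val a, val b, (val c, val d)).
  have x0 : sums_to_zero x by apply/eqP.
  have fresh i : i \in [:: x.1.1; x.1.2; x.2.1; x.2.2] ->
      i \notin index_support C :|: index_support C'.
    by rewrite !inE => /or4P[] /eqP->; [move: (valP a) | move: (valP b) | move: (valP c) | move: (valP d)];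
       rewrite !inE.
  apply/andP; split; apply: contraT.
    by move/(Cmax x x0) => [i iC /fresh]; rewrite inE iC.
  by move/(C'max x x0) => [i iC /fresh]; rewrite inE iC orbT.
- exact: aux.1.
- exact: aux.2.
Qed.
End Selection.

(** * Counting cycles *)

Definition sum_reps (V : finZmodType) (A B : {set V}) (y : V) : nat :=
  #|[set t : V * V | [&& t.1 \in A, t.2 \in B & (t.1 + t.2 == y)%R]]|.

Section Representations.
Local Open Scope ring_scope.
Variable V : finZmodType.
Implicit Types (X : nat -> {set V}) (s : V).

(** Indexing the sets by [nat] turns the removal of leading coordinates into a shift of [X]. *)
Fixpoint reps (k : nat) X s : nat :=
  if k is k'.+1 then (\sum_(x in X 0%nat) reps k' (fun i => X i.+1) (s - x)%R)%nat
  else (s == 0) : nat.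

(** This reduces merging coordinates 0 and 2 to merging coordinates 0 and 1. *)
Lemma reps_swap k X s (X' := fun i => if i is 1%nat then X 2%nat else if i is 2%nat then X 1%nat else X i) :
  reps k.+3 X' s = reps k.+3 X s.
Proof.
rewrite /=; apply: eq_bigr => x _; rewrite exchange_big /=; apply: eq_bigr => y _.
by apply: eq_bigr => z _; rewrite addrAC.
Qed.

Lemma reps3_triangles X : reps 3 X 0 = #|triangles (fun i : 'I_3 => X i)|.
Proof.
rewrite /= pair_big_dep /=.
rewrite -sum1_card.
transitivity (\sum_(t : V * V | (t.1 \in X 0%nat) && (t.2 \in X 1%nat)) ((- (t.1 + t.2))%R \in X 2%nat))%nat.
  apply: eq_bigr => [[x y]] _ /=.
  rewrite big_mkcond (bigD1 (- (x + y))) //= big1 ?addn0 => [|z /negbTE ne].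
    by rewrite sub0r -opprD opprK addNr eqxx; case: ifP.
  rewrite sub0r -opprD subr_eq0 eq_sym ne; by case: ifP.
rewrite big_mkcond [RHS]big_mkcond; apply: eq_bigr => t _.
rewrite inE; have -> : [forall i : 'I_3, corner i t \in X i] =
  [&& t.1 \in X 0%nat, t.2 \in X 1%nat & - (t.1 + t.2) \in X 2%nat].
  apply/forallP/and3P => [H|[H0 H1 H2]]; first by split; [have := H 0 | have := H 1 | have := H (2%:R)].
  exact: ord3P.
by case: (t.1 \in _); case: (t.2 \in _).
Qed.

(** A representation of [y] and a completion with sum [- y] join into a cycle, and [y] can be
    recovered from that cycle. *)
Lemma reps_merge k X (Y : {set V}) :
  (\sum_(y in Y) sum_reps (X 0%nat) (X 1%nat) y * reps k (fun i => X i.+2) (- y)%R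
     <= reps k.+2 X 0%R)%nat.
Proof.
rewrite /= pair_big_dep /=.
apply: (@leq_trans (\sum_(y in Y) \sum_(t : V * V | (t.1 \in X 0%nat) && (t.2 \in X 1%nat))
   (t.1 + t.2 == y)%R * reps k (fun i => X i.+2) (- y)%R))%nat.
  apply: leq_sum => y _; rewrite -big_distrl /= leq_mul2r; apply/orP; right.
  rewrite /sum_reps -sum1dep_card big_mkcond /= [leqRHS]big_mkcond /=.
  by apply: leq_sum => t _; case: (t.1 \in _); case: (t.2 \in _) => //=; case: ifP.
rewrite exchange_big /=; apply: leq_sum => t _.
case: (boolP (t.1 + t.2 \in Y)) => tY.
  rewrite (bigD1 (t.1 + t.2)) //= eqxx mul1n big1 ?addn0 => [|y /andP[_ /negbTE]].
    by rewrite sub0r opprD.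
  by rewrite eq_sym => ->.
by rewrite big1 // => y yY; case: eqP tY => // ->; rewrite yY.
Qed.

Definition disjoint_cycles (k : nat) X (J : finType) (f : nat -> J -> V) : Prop :=
  [/\ forall i, (i < k)%nat -> injective (f i),
      forall i j, (i < k)%nat -> f i j \in X i &
      forall j, \sum_(i < k) f i j = 0].
End Representations.

(** * Tensor squares of systems of cycles *)

Section TensorSquare.
Local Open Scope ring_scope.
Variable p : nat.

Definition row_square n (A : {set 'rV['F_p]_n}) : {set 'rV['F_p]_(n + n)} :=
  [set row_mx x.1 x.2 | x in setX A A].

Lemma row_pair_inj n : injective (fun x : 'rV['F_p]_n * 'rV['F_p]_n => row_mx x.1 x.2).
Proof. by move=> [x y] [x' y'] /= /eq_row_mx [-> ->]. Qed.

Lemma reps_square n k (X : nat -> {set 'rV['F_p]_n}) s s' :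
  reps k (fun i => row_square (X i)) (row_mx s s') = (reps k X s * reps k X s')%nat.
Proof.
elim: k X s s' => [|k IHk] X s s' /=.
  have -> : (0 : 'rV['F_p]_(n + n)) = row_mx 0 0 by rewrite row_mx0.
  by rewrite (inj_eq (@row_pair_inj n) (s, s') (0, 0)) mulnb.
rewrite big_imset /=; last by move=> x y _ _; apply: row_pair_inj.
rewrite big_distrlr /= pair_big_dep /=; apply: eq_big => [x|x _]; first by rewrite inE.
by rewrite opp_row_mx add_row_mx IHk.
Qed.

Lemma disjoint_cycles_square n k (X : nat -> {set 'rV['F_p]_n}) (J : finType)
  (f : nat -> J -> 'rV['F_p]_n) :
  disjoint_cycles k X f ->
  disjoint_cycles k (fun i => row_square (X i)) (fun i (j : J * J) => row_mx (f i j.1) (f i j.2)).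
Proof.
move=> [f_inj fX f0]; split=> [i ik [j1 j2] [j1' j2'] /= /eq_row_mx[/(f_inj i ik)-> /(f_inj i ik)->] //|i j ik|j].
  by apply/imsetP; exists (f i j.1, f i j.2); rewrite ?inE ?fX.
have row_sum (F G : 'I_k -> 'rV['F_p]_n) :
    \sum_i row_mx (F i) (G i) = row_mx (\sum_i F i) (\sum_i G i).
  by elim/big_rec3: _ => [|i x y z _ ->]; rewrite ?row_mx0 ?add_row_mx.
by rewrite (row_sum (fun i => f i j.1) (fun i => f i j.2)) !f0 row_mx0.
Qed.

(** The matching size, the cycle count and the size of the ambient space are all raised to the power
    [2^s]. *)
Lemma iterated_square n k (X : nat -> {set 'rV['F_p]_n}) (J : finType)
  (f : nat -> J -> 'rV['F_p]_n) (s : nat) :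
  disjoint_cycles k X f -> exists (X' : nat -> {set 'rV['F_p]_(n * expn 2 s)}) (J' : finType) f',
    [/\ @disjoint_cycles _ k X' J' f', #|J'| = expn #|J| (expn 2 s) &
      reps k X' 0 = expn (reps k X 0) (expn 2 s)].
Proof.
move=> cyc; elim: s => [|s [X' [J' [f' [cyc' J'E repsE]]]]].
  by rewrite expn0 muln1; exists X, J, f; rewrite !expn1.
have -> : (n * expn 2 s.+1 = n * expn 2 s + n * expn 2 s)%nat by rewrite expnS mulnCA mul2n addnn.
exists (fun i => row_square (X' i)), (J' * J')%type, (fun i j => row_mx (f' i j.1) (f' i j.2)).
have E x : expn x (expn 2 s.+1) = (expn x (expn 2 s) * expn x (expn 2 s))%nat.
  by rewrite expnS mul2n -addnn expnD.
split; first exact: disjoint_cycles_square.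
  by rewrite card_prod J'E E.
by rewrite -[0]row_mx0 reps_square repsE E.
Qed.
End TensorSquare.

Section CountCycles.
Local Open Scope ring_scope.
Variable V : finZmodType.

Lemma reps_le_card k (X : nat -> {set V}) (s : V) :
  (reps k X s <= #|[set x : {ffun 'I_k -> V} | [forall i, x i \in X i] && (\sum_i x i == s)%R]|)%nat.
Proof.
elim: k X s => [|k IHk] X s.
  rewrite /=; case: eqP => // ->; apply/card_gt0P; exists [ffun=> 0].
  by rewrite inE big_ord0 eqxx andbT; apply/forallP => [[]].
rewrite -sum1_card (partition_big (fun x : {ffun 'I_k.+1 -> V} => x ord0) (fun y => y \in X 0%nat)) /=; last first.
  by move=> x; rewrite inE => /andP[/forallP/(_ ord0)].
apply: leq_sum => y yX; apply: leq_trans (IHk _ _) _; rewrite sum1dep_card.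
pose cons (h : {ffun 'I_k -> V}) : {ffun 'I_k.+1 -> V} :=
  [ffun i => if unlift ord0 i is Some j then h j else y].
have consS h j : cons h (lift ord0 j) = h j by rewrite ffunE liftK.
have cons0 h : cons h ord0 = y by rewrite ffunE unlift_none.
have cons_inj : injective cons.
  by move=> h h' E; apply/ffunP => j; rewrite -!consS E.
rewrite -(card_imset _ cons_inj); apply: subset_leq_card; apply/subsetP => _ /imsetP[h + ->].
rewrite !inE => /andP[/forallP hX /eqP h_sum]; rewrite cons0 eqxx andbT; apply/andP; split.
  apply/forallP => i; case: (unliftP ord0 i) => [j ->|->]; last by rewrite cons0.
  by rewrite consS; apply: hX.
rewrite big_ord_recl cons0; under eq_bigr do rewrite consS.
by rewrite h_sum addrC subrK.
Qed.
End CountCycles.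

From mathcomp Require Import Rstruct.
From Stdlib Require Import Reals Lra.
Delimit Scope ring_scope with ring.

Local Open Scope R_scope.

(** * Three-cycle removal *)

(** From [exp (- y) >= 1 - y] one gets [exp y <= 1 / (1 - y)], and [(1 + y + 2 y^2) (1 - y) = 1 +
    y^2 (1 - 2 y)] is at least 1. *)
Lemma exp_le_quadratic (y : R) : y <= 1 / 2 -> exp y <= 1 + y + 2 * y ^ 2.
Proof.
move=> y2; have y_pos : 0 < 1 - y by lra.
have e1 : exp y * (1 - y) <= 1.
  apply: (Rle_trans _ (exp y * exp (- y))).
    apply: Rmult_le_compat_l; first exact/Rlt_le/exp_pos.
    have := exp_ineq1_le (- y); lra.
  by rewrite -exp_plus Rplus_opp_r exp_0; apply: Rle_refl.
apply: (Rmult_le_reg_r (1 - y)) => //; apply: Rle_trans e1 _.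
have : 0 <= y ^ 2 * (1 - 2 * y) by apply: Rmult_le_pos; [exact: pow2_ge_0 | lra].
lra.
Qed.

Lemma sum_affine (a b : R) (m : nat) :
  sum_f_R0 (fun i => a + b * INR i) m = (INR m + 1) * a + b * (INR m * (INR m + 1) / 2).
Proof.
elim: m => [|m IHm]; first by rewrite /=; lra.
rewrite tech5 IHm S_INR; field.
Qed.

(* At t = exp (-3x) and with q = p - 1, the quotient is the sum over i <= q of exp ((q - 3i) x),
   whose first-order term - p q x / 2 is negative. *)
Lemma c_p3_pos (p : nat) (c : R) : prime p -> is_c_p3 p c -> 0 < c.
Proof.
move=> p_prime [c_lb _].
have p1 : INR p = INR (p - 1) + 1.
  by rewrite -S_INR; congr INR; move: (prime_gt0 p_prime); case: (p) => // m _; rewrite subn1.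
have q1 : 1 <= INR (p - 1).
  by apply: (le_INR 1); apply/ssrnat.leP; rewrite subn_gt0 prime_gt1.
set q := INR (p - 1) in p1 q1.
(* With [u = q x] the final estimate is [(q + 1) (1 - u / 2 + 8 u^2)], below [p = q + 1] once
   [u < 1 / 16]. *)
pose x := / (32 * q).
have x_pos : 0 < x by apply: Rinv_0_lt_compat; lra.
have qx : q * x = / 32 by rewrite /x; field; lra.
apply: Rnot_le_lt => c0.
have p_le : INR p <= cp3_fun p (exp (- 3 * x)).
  apply: Rle_trans (c_lb _ _); last first.
    exists (exp (- 3 * x)); split=> //; split; first exact: exp_pos.
    by rewrite -exp_0; apply: exp_increasing; lra.
  rewrite -{1}(Rpower_1 (INR p)); last lra.
  by apply: Rle_Rpower; lra.
suff : cp3_fun p (exp (- 3 * x)) < INR p by lra.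
rewrite /cp3_fun /Rpower ln_exp p1.
have -> : (q + 1 - 1) / 3 * (- 3 * x) = - (q * x) by field.
rewrite /Rdiv -exp_Ropp Ropp_involutive Rmult_comm scal_sum.
apply: Rle_lt_trans (_ : sum_f_R0 (fun i => (1 + q * x + 8 * (q * x) ^ 2) + (- 3 * x) * INR i) (p - 1) < _).
  apply: sum_Rle => i i_le.
  have i_q : INR i <= q by apply: le_INR.
  have i0 := pos_INR i.
  have -> : exp (- 3 * x) ^ i * exp (q * x) = exp (q * x - 3 * x * INR i).
    rewrite -Rpower_pow; last exact: exp_pos.
    by rewrite /Rpower ln_exp -exp_plus; congr exp; ring.
  apply: Rle_trans (exp_le_quadratic _) _.
    have : 0 <= x * INR i by apply: Rmult_le_pos; lra.
    lra.
  have xi : 0 <= x * INR i <= q * x.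
    by split; [apply: Rmult_le_pos; lra | rewrite Rmult_comm; apply: Rmult_le_compat_r; lra].
  have : (q * x - 3 * x * INR i) ^ 2 <= 4 * (q * x) ^ 2 by nra.
  lra.
rewrite sum_affine -/q qx.
have -> : - 3 * x * (q * (q + 1) / 2) = - (3 / 2) * (q * x) * (q + 1) by field.
rewrite qx; nra.
Qed.

(** The infimum is not assumed to be attained: the [d]-th root of the count is a lower bound of all
    quotients, hence at most their infimum. *)
Lemma low_monomials_le (p d : nat) (c : R) : prime p -> is_c_p3 p c ->
  INR #|low_monomials p d| <= Rpower (INR p) ((1 - c) * INR d).
Proof.
move=> p_prime [_ c_glb].
have p_pos : 0 < INR p by apply: lt_0_INR; apply/ssrnat.ltP; exact: prime_gt0.
have pm1 : INR (p - 1) = INR p - 1.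
  by rewrite minus_INR //; apply/ssrnat.leP; exact: prime_gt0.
set L := #|_|.
have L_pos : 0 < INR L.
  apply: lt_0_INR; apply/ssrnat.ltP; apply/card_gt0P.
  exists [ffun=> Ordinal (prime_gt0 p_prime)]; rewrite inE big1 ?muln0 // => j _.
  by rewrite ffunE.
have L_le t : 0 < t < 1 -> INR L <= cp3_fun p t ^ d.
  move=> [t0 t1]; (* Cube roots clear the denominator of the exponent (p - 1) / 3. *)
  pose s := Rpower t (1 / 3).
  have s0 : 0 < s by apply: exp_pos.
  have s3 i : s ^ (3 * i) = t ^ i.
    rewrite pow_mult -(Rpower_pow 3 s) // Rpower_mult.
    by rewrite (_ : 1 / 3 * INR 3 = 1) ?Rpower_1 //=; field.
  have s1 : s <= 1.
    apply: Rnot_lt_le => s1; have := s3 1%nat; rewrite pow_1 => E.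
    have lt1 : 1 < s ^ (3 * 1) by apply: Rlt_pow_R1 => //; apply/ssrnat.ltP.
    by move: lt1; rewrite E; lra.
  have sp : s ^ (p - 1) = Rpower t ((INR p - 1) / 3).
    by rewrite -(Rpower_pow _ s) // Rpower_mult pm1; congr Rpower; field.
  have sp0 : 0 < s ^ (p - 1) by apply: pow_lt.
  have := @low_monomials_generating R p d s; rewrite -/L.
  move=> /(_ (introT RltP s0) (introT RleP s1)) /RleP.
  have -> : (\sum_(i < p) s ^+ (3 * i))%ring = sum_f_R0 (fun i => t ^ i) (p - 1).
    rewrite sum_f_R0E subn1 prednK ?prime_gt0 // big_mkord.
    by apply: eq_bigr => i _; rewrite -RpowE s3.
  rewrite -INRE -!RpowE pow_mult -RmultE => gen.
  rewrite /cp3_fun -sp /Rdiv Rpow_mult_distr pow_inv.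
  apply: (Rmult_le_reg_r ((s ^ (p - 1)) ^ d)); first exact: pow_lt.
  rewrite Rmult_assoc Rinv_l ?Rmult_1_r //.
  exact/Rgt_not_eq/pow_lt.
have [d0|d_pos] := posnP d.
  have := L_le (1 / 2) ltac:(lra).
  by rewrite d0 /= Rmult_0_r Rpower_O.
have dR : 0 < INR d by apply: lt_0_INR; apply/ssrnat.ltP.
have root_le : Rpower (INR L) (/ INR d) <= Rpower (INR p) (1 - c).
  apply: c_glb => _ [t [t01 ->]].
  have f_pos : 0 < cp3_fun p t.
    apply: Rmult_lt_0_compat; last exact/Rinv_0_lt_compat/exp_pos.
    by apply: tech1 => i _; apply: pow_lt; case: t01.
  apply: Rle_trans (Rle_Rpower_l _ _ _ _ (conj L_pos (L_le t t01))) _.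
    by apply/Rlt_le/Rinv_0_lt_compat.
  rewrite -Rpower_pow // Rpower_mult Rinv_r ?Rpower_1 //; last lra.
  exact: Rle_refl.
have -> : INR L = Rpower (Rpower (INR L) (/ INR d)) (INR d).
  by rewrite Rpower_mult Rinv_l ?Rpower_1 //; lra.
rewrite -Rpower_mult; apply: Rle_Rpower_l; first lra.
by split=> //; apply: exp_pos.
Qed.

Lemma INR_expn (p n : nat) : INR (expn p n) = INR p ^ n.
Proof. by elim: n => [|n IHn] //; rewrite expnS mult_INR IHn. Qed.

Lemma leq_INR (a b : nat) : (a <= b)%nat -> INR a <= INR b.
Proof. by move/ssrnat.leP/le_INR. Qed.

Lemma ltn_INR (a b : nat) : (a < b)%nat -> INR a < INR b.
Proof. by move/ssrnat.ltP/lt_INR. Qed.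

Lemma Rpower_ge1 (x y : R) : 1 <= x -> 0 <= y -> 1 <= Rpower x y.
Proof.
move=> x1 y0; rewrite -(Rpower_O x); last lra.
by case: x1 => [x1|<-]; [apply: Rle_Rpower; lra | rewrite /Rpower ln_1 !Rmult_0_r; apply: Rle_refl].
Qed.

Lemma Rpower_inv (x y : R) : 0 < x -> Rpower (/ x) y = Rpower x (- y).
Proof. by move=> x0; rewrite /Rpower ln_Rinv //; congr exp; ring. Qed.

Section ThreeCycles.
Variables (p : nat) (c : R).
Hypotheses (p_prime : prime p) (c_def : is_c_p3 p c).
Let c_pos : 0 < c := c_p3_pos p_prime c_def.

Lemma p_ge2 : 2 <= INR p.
Proof. by apply: (leq_INR (prime_gt1 p_prime)). Qed.

Lemma expn_p_pos n : 0 < INR (expn p n).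
Proof. by apply: (@ltn_INR 0); rewrite expn_gt0 prime_gt0. Qed.

Lemma card_row n : #|{: 'rV['F_p]_n}| = expn p n.
Proof. by rewrite card_mx mul1n card_Fp. Qed.

(** Sampling in the largest dimension [d] with [p^d <= N / (6 Delta)] gives at most
    [6 N^2 p^(-(1 + c) d)] triangles. The factor [p] in the base pays for rounding [d] down. *)
Lemma triangles_le_degree (n : nat) (X : 'I_3 -> {set 'rV['F_p]_n}) (Delta : nat) :
  (0 < Delta)%nat -> (forall i x, degree X i x <= Delta)%nat ->
  INR #|triangles X| <=
    6 * INR (expn p n) ^ 2 * Rpower (6 * INR p * INR Delta / INR (expn p n)) (1 + c).
Proof.
move=> D_gt0 degX; set N := expn p n; set T := #|_|.
have N_pos : 0 < INR N := expn_p_pos n.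
have D_pos : 1 <= INR Delta by apply: (@leq_INR 1).
have p2 := p_ge2.
have INR6 : INR 6 = 6 by rewrite /=; lra.
have [small|large] := leqP (6 * Delta) N.
  pose d := trunc_log p (N %/ (6 * Delta)).
  have D6 : (0 < 6 * Delta)%nat by rewrite muln_gt0.
  have /andP[d_le d_gt] : (expn p d <= N %/ (6 * Delta) < expn p d.+1)%nat.
    by apply: trunc_log_bounds; rewrite ?prime_gt1 // divn_gt0.
  rewrite leq_divRL // in d_le; rewrite ltn_divLR // in d_gt.
  have d_le' : (6 * expn p d * Delta <= N)%nat by rewrite mulnAC mulnC.
  have := leq_INR (sampling_bound p_prime degX d_le').
  have Ld := low_monomials_le d p_prime c_def.
  rewrite -/N -/T !mult_INR INR6 => bound.
  move: bound Ld; set L := INR #|_|; set g := INR (expn p d) => bound Ld.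
  have g_pos : 0 < g := expn_p_pos d.
  have {}Ld : L <= Rpower g (1 - c).
    apply: Rle_trans Ld _; rewrite Rmult_comm -Rpower_mult Rpower_pow; last lra.
    by rewrite -INR_expn; apply: Rle_refl.
  have gb : / g <= 6 * INR p * INR Delta / INR N.
    apply: (Rmult_le_reg_r (INR N)) => //; apply: (Rmult_le_reg_l g) => //.
    have -> : g * (/ g * INR N) = INR N by field; lra.
    have -> : g * (6 * INR p * INR Delta / INR N * INR N) = (INR p * g) * (6 * INR Delta) by field; lra.
    move/ltn_INR: d_gt; rewrite !mult_INR INR6 expnS mult_INR -/g; lra.
  apply: (Rle_trans _ (6 * INR N ^ 2 * Rpower (/ g) (1 + c))); last first.
    apply: Rmult_le_compat_l; first by have := pow2_ge_0 (INR N); lra.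
    by apply: Rle_Rpower_l; [lra | split=> //; apply: Rinv_0_lt_compat].
  apply: (Rmult_le_reg_l (g ^ 2)); first exact: pow_lt.
  have -> : g ^ 2 * (6 * INR N ^ 2 * Rpower (/ g) (1 + c)) = 6 * Rpower g (1 - c) * INR N ^ 2.
    rewrite Rpower_inv // -(Rpower_pow 2 g) //.
    rewrite (_ : 1 - c = INR 2 + - (1 + c)); last by rewrite /=; ring.
    by rewrite Rpower_plus; ring.
  have -> : INR N ^ 2 = INR N * INR N by ring.
  have -> : g ^ 2 = g * g by ring.
  apply: Rle_trans bound _.
  by apply: Rmult_le_compat_r; [nra | lra].
(* If [6 Delta > N], the base of the power exceeds 1 and the trivial bound [N^2] suffices. *)
apply: (Rle_trans _ (INR N ^ 2)).
  rewrite -INR_expn; apply: leq_INR; apply: leq_trans (max_card _) _.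
  by rewrite card_prod card_row mulnn.
have N2 : 0 < INR N ^ 2 by apply: pow_lt.
suff : 1 <= Rpower (6 * INR p * INR Delta / INR N) (1 + c) by nra.
apply: Rpower_ge1; last lra.
apply: (Rmult_le_reg_r (INR N)) => //.
have -> : 6 * INR p * INR Delta / INR N * INR N = INR p * (6 * INR Delta) by field; lra.
move/ltn_INR: large; rewrite mult_INR INR6.
nra.
Qed.

End ThreeCycles.

Section Cascade.
Variables (p : nat) (c : R).
Hypotheses (p_prime : prime p) (c_def : is_c_p3 p c).
Let c_pos : 0 < c := c_p3_pos p_prime c_def.

Lemma scaled_power (a D N : R) : 0 < a -> 0 < D -> 0 < N ->
  N ^ 2 * Rpower (a * D / N) (1 + c) = Rpower a (1 + c) * N * D * Rpower (D / N) c.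
Proof.
move=> a0 D0 N0.
have DN : 0 < D / N by apply: Rdiv_lt_0_compat.
have -> : a * D / N = a * (D / N) by field; lra.
rewrite -Rpower_mult_distr // (Rpower_plus _ _ (D / N)).
rewrite (Rpower_1 (D / N)) //; field; lra.
Qed.

(** Pruning from degree [2^(e+1)] to [2^e] loses at most [36 A N (2^(e+1) / N)^c] triples of the
    matching, and these losses shrink geometrically with [e]. *)
Lemma matching_le_degree : exists2 C, 0 < C &
  forall (n e : nat) (X : 'I_3 -> {set 'rV['F_p]_n}) S,
  triangle_matching X S -> (forall i x, degree X i x <= expn 2 e)%nat ->
  INR #|S| <= C * INR (expn p n) * Rpower (2 ^ e / INR (expn p n)) c.
Proof.
pose A := Rpower (6 * INR p) (1 + c).
have A_pos : 0 < A by apply: exp_pos.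
have p2 := p_ge2 p_prime.
pose r := Rpower 2 (- c).
have r1 : r < 1 by rewrite -(Rpower_O 2); [apply: Rpower_lt; lra | lra].
have r0 : 0 < r by apply: exp_pos.
(* The fixed point of C |-> C 2^-c + 36 A, that is, the sum of the geometric series. *)
pose C := 36 * A / (1 - r).
have CA : C * r + 36 * A = C by rewrite /C; field; lra.
have C_pos : 0 < C by apply: Rdiv_lt_0_compat; lra.
have T_le n e (X : 'I_3 -> {set 'rV['F_p]_n}) : (forall i x, degree X i x <= expn 2 e)%nat ->
    INR #|triangles X| <= 6 * A * INR (expn p n) * 2 ^ e * Rpower (2 ^ e / INR (expn p n)) c.
  move=> /(triangles_le_degree p_prime c_def (expn_gt0 2 e)).
  have N_pos := expn_p_pos p_prime n; have e_pos : 0 < 2 ^ e by apply: pow_lt; lra.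
  rewrite (INR_expn 2 e) Rmult_assoc (_ : INR 2 = 2) // scaled_power //; last lra.
  rewrite -/A; lra.
exists C => // n e; have N_pos := expn_p_pos p_prime n.
elim: e => [|e IHe] X S matchS degX.
  have ST : INR #|S| <= INR #|triangles X| by apply/leq_INR/subset_leq_card; case: matchS.
  apply: Rle_trans ST _; apply: Rle_trans (T_le _ _ _ degX) _; rewrite /= Rmult_1_r.
  apply: Rmult_le_compat_r; first exact/Rlt_le/exp_pos.
  apply: Rmult_le_compat_r; first lra.
  have : 0 < C * r by apply: Rmult_lt_0_compat.
  lra.
have [X' [S' [matchS' degX' S_le]]] := prune_high_degree (expn 2 e) matchS.
have {IHe} := IHe _ _ matchS' degX'.
have := T_le _ _ _ degX.
move/leq_INR: S_le; rewrite plus_INR !mult_INR (INR_expn 2 e) (_ : INR 2 = 2) // (_ : INR 3 = 3); last by rewrite /=; lra.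
have e_pos : 0 < 2 ^ e by apply: pow_lt; lra.
have -> : 2 ^ e.+1 = 2 * 2 ^ e by [].
set N := INR (expn p n) in N_pos *.
have -> : Rpower (2 ^ e / N) c = r * Rpower (2 * 2 ^ e / N) c.
  have -> : 2 ^ e / N = / 2 * (2 * 2 ^ e / N) by field; lra.
  rewrite -Rpower_mult_distr ?Rpower_inv //; try lra.
  by apply: Rdiv_lt_0_compat; lra.
set B := Rpower (_ / N) c; have B_pos : 0 < B by apply: exp_pos.
move=> S_le T_le' IHe.
apply: (Rmult_le_reg_r (2 ^ e)) => //.
apply: Rle_trans S_le _.
rewrite -CA.
have : INR #|S'| * 2 ^ e <= C * N * (r * B) * 2 ^ e by apply: Rmult_le_compat_r; lra.
lra.
Qed.
End Cascade.

Section ThreeCycleRemoval.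
Variables (p : nat) (c : R).
Hypotheses (p_prime : prime p) (c_def : is_c_p3 p c).
Let c_pos : 0 < c := c_p3_pos p_prime c_def.

(** With [M] triples in the matching and [T] triangles, prune at the least [2^e] with
    [6 T <= M 2^e]. Half of the matching survives, so [M / N <= 2 C (2^e / N)^c], while minimality
    gives [2^e < 12 T / M]. *)
Lemma three_cycle_removal : exists2 c0, 0 < c0 &
  forall n (X : 'I_3 -> {set 'rV['F_p]_n}) S, triangle_matching X S -> (0 < #|S|)%nat ->
  c0 * INR (expn p n) ^ 2 * Rpower (INR #|S| / INR (expn p n)) (1 + / c) <= INR #|triangles X|.
Proof.
have INR6 : INR 6 = 6 by rewrite /=; lra.
have INR3 : INR 3 = 3 by rewrite /=; lra.
have INR2 : INR 2 = 2 by [].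
have [C C_pos matching_le] := matching_le_degree p_prime c_def.
have b_pos : 0 < / (2 * C) by apply: Rinv_0_lt_compat; lra.
exists (/ 12 * Rpower (/ (2 * C)) (/ c)).
  by apply: Rmult_lt_0_compat; [lra | apply: exp_pos].
move=> n X S matchS S_gt0; have N_pos := expn_p_pos p_prime n.
set N := INR (expn p n) in N_pos *; set T := INR #|triangles X|.
have M_ge1 : 1 <= INR #|S| by apply: (@leq_INR 1).
have ST : INR #|S| <= T by apply/leq_INR/subset_leq_card; case: matchS.
set M := INR #|S| in M_ge1 ST *.
have ex_e : exists e, (6 * #|triangles X| <= #|S| * expn 2 e)%nat.
  exists (6 * #|triangles X|)%nat; apply: leq_trans (ltnW (ltn_expl _ (isT : 1 < 2)%nat)) _.
  by rewrite leq_pmull.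
case: (ex_minnP ex_e) => e e_ge e_min.
have {}e_ge : 6 * T <= M * 2 ^ e.
  by move/leq_INR: e_ge; rewrite !mult_INR (INR_expn 2 e) INR2 INR6.
have e_lt : M * 2 ^ e < 12 * T.
  (* Minimality says nothing for [e = 0], where [M <= T] is used instead. *)
  have [e0|e_gt0] := posnP e; first by move: e_ge; rewrite e0 /=; lra.
  have : ~~ (6 * #|triangles X| <= #|S| * expn 2 e.-1)%nat.
    by apply/negP => /e_min; rewrite leqNgt prednK ?leqnn.
  rewrite -ltnNge => /ltn_INR; rewrite !mult_INR (INR_expn 2 e.-1) INR2 INR6 -/T -/M.
  rewrite -{2}(prednK e_gt0) /=; lra.
have [X' [S' [matchS' degX' S_le]]] := prune_high_degree (expn 2 e) matchS.
have := matching_le _ _ _ _ matchS' degX'; rewrite -/N.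
move/leq_INR: S_le; rewrite plus_INR !mult_INR (INR_expn 2 e) INR2 INR3.
rewrite -/M -/T; set M' := INR #|S'| => S_le M'_le.
have e_pos : 0 < 2 ^ e by apply: pow_lt; lra.
have half : M <= 2 * M' by apply: (Rmult_le_reg_r (2 ^ e)) => //; lra.
pose q := 12 * T / (M * N).
have MN_pos : 0 < M * N by apply: Rmult_lt_0_compat; lra.
have qe : 2 ^ e / N <= q.
  apply: (Rmult_le_reg_r (M * N)) => //.
  have -> : 2 ^ e / N * (M * N) = M * 2 ^ e by field; lra.
  have -> : q * (M * N) = 12 * T by rewrite /q; field; split; lra.
  lra.
have qc : / (2 * C) * (M / N) <= Rpower q c.
  apply: (Rmult_le_reg_r (2 * C * N)); first by apply: Rmult_lt_0_compat; lra.
  have -> : / (2 * C) * (M / N) * (2 * C * N) = M by field; lra.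
  have : Rpower (2 ^ e / N) c <= Rpower q c.
    by apply: Rle_Rpower_l; [lra | split=> //; apply: Rdiv_lt_0_compat].
  have CN : 0 <= C * N by apply: Rmult_le_pos; lra.
  move=> /(Rmult_le_compat_l _ _ _ CN); lra.
have MN : 0 < M / N by apply: Rdiv_lt_0_compat; lra.
have q_pos : 0 < q by apply: Rdiv_lt_0_compat; lra.
have : Rpower (/ (2 * C)) (/ c) * Rpower (M / N) (/ c) <= q.
  rewrite Rpower_mult_distr //.
  have -> : q = Rpower (Rpower q c) (/ c).
    by rewrite Rpower_mult Rinv_r ?Rpower_1 //; lra.
  apply: Rle_Rpower_l; first exact/Rlt_le/Rinv_0_lt_compat.
  by split=> //; apply: Rmult_lt_0_compat.
move=> q_ge; apply: Rle_trans (_ : / 12 * (M * N) * q <= T); last first.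
  by apply: Req_le; rewrite /q; field; split; lra.
rewrite Rpower_plus Rpower_1 //.
have -> : / 12 * Rpower (/ (2 * C)) (/ c) * N ^ 2 * (M / N * Rpower (M / N) (/ c)) =
  / 12 * (M * N) * (Rpower (/ (2 * C)) (/ c) * Rpower (M / N) (/ c)) by field; lra.
by apply: Rmult_le_compat_l; lra.
Qed.

(** If more than half of the sums were unpopular, their negatives as a third part would give a large
    triangle matching, hence many triangles. But the triangles are at most the sum of the
    representation counts of these sums. *)
Lemma popular_sums : exists2 c1, 0 < c1 &
  forall n (A B : {set 'rV['F_p]_n}) (J : finType) (f g : J -> 'rV['F_p]_n),
  injective f -> injective g -> injective (fun j => f j + g j)%ring ->
  (forall j, f j \in A) -> (forall j, g j \in B) -> (0 < #|J|)%nat ->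
  exists2 J' : {set J}, (#|J| <= 2 * #|J'|)%nat &
   forall j, j \in J' -> c1 * INR (expn p n) * Rpower (INR #|J| / INR (expn p n)) (/ c) <=
      INR (sum_reps A B (f j + g j)%ring).
Proof.
have [c0 c0_pos removal] := three_cycle_removal.
have h_pos : 0 < Rpower (/ 2) (/ c) by apply: exp_pos.
(* The power of [/ 2] pays for passing to half of the indices; the last factor [1 / 2] makes the
   contradiction strict. *)
pose c1 := c0 * Rpower (/ 2) (/ c) / 2.
have c1_pos : 0 < c1 by rewrite /c1; have := Rmult_lt_0_compat _ _ c0_pos h_pos; lra.
exists c1 => // n A B J f g f_inj g_inj y_inj fA gB J_gt0.
have N_pos := expn_p_pos p_prime n; set N := INR (expn p n) in N_pos *.
have J_ge1 : 1 <= INR #|J| by apply: (@leq_INR 1).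
set rho := c1 * N * _.
pose r j := sum_reps A B (f j + g j)%ring.
pose J' := [set j | is_left (Rle_dec rho (INR (r j)))].
have J'P j : reflect (rho <= INR (r j)) (j \in J').
  by rewrite inE; case: Rle_dec => /= ?; constructor.
exists J'; last by move=> j /J'P.
rewrite leqNgt; apply/negP => J'_small.
pose bad := ~: J'.
have bad_big : (#|J| < 2 * #|bad|)%nat by have := cardsC J'; rewrite -/bad; lia.
pose X : 'I_3 -> {set 'rV['F_p]_n} := fun i =>
  if i == 0%ring then A else if i == 1%ring then B else [set (- (f j + g j))%ring | j in bad].
pose h j := (f j, g j).
have h_inj : injective h by move=> j j' [/f_inj].
have corner_h i : injective (fun j => corner i (h j)).
  elim/ord3P: i; rewrite /corner /=; [exact: f_inj | exact: g_inj |].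
  by move=> j j' /oppr_inj/y_inj.
have matchS : triangle_matching X (h @: bad).
  split=> [|i t t' /imsetP[j _ ->] /imsetP[j' _ ->] /corner_h -> //].
  apply/subsetP => t /imsetP[j jbad ->]; rewrite inE; apply/forallP.
  by apply: ord3P; rewrite /X /corner /= ?fA ?gB //; apply: imset_f.
have card_h : #|h @: bad| = #|bad| by rewrite card_imset.
have := removal _ _ _ matchS; rewrite card_h => /(_ ltac:(lia)); rewrite -/N.
have T_le : (#|triangles X| <= \sum_(j in bad) r j)%nat.
  rewrite -sum1_card.
  apply: (@leq_trans (\sum_(t in triangles X) \sum_(j in bad)
    [&& t.1 \in A, t.2 \in B & (t.1 + t.2 == f j + g j)%ring]))%nat.
    apply: leq_sum => t; rewrite inE => /forallP Xt.
    have := Xt 0%ring; have := Xt 1%ring; have := Xt (2%:R)%ring.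
    rewrite /X /corner /= => /imsetP[j jbad /oppr_inj E] t2 t1.
    by rewrite (bigD1 j) //= t1 t2 E eqxx.
  rewrite exchange_big /=; apply: leq_sum => j _.
  rewrite /r /sum_reps -sum1dep_card big_mkcond /= [leqRHS]big_mkcond /=.
  by apply: leq_sum => t _; case: ifP => // _; case: ifP.
have bad_r : INR (\sum_(j in bad) r j) <= INR #|bad| * rho.
  apply: (Rle_trans _ (INR #|bad| * rho)); last exact: Rle_refl.
  rewrite -sum1_card; elim/big_rec2: _ => [|j a b jbad IH]; first by rewrite /=; lra.
  move: jbad; rewrite inE => /J'P/Rnot_le_lt rj.
  rewrite !plus_INR /= in IH *; lra.
have bad_pos : 1 <= INR #|bad| by apply: (@leq_INR 1); lia.
have {}bad_big : INR #|J| <= 2 * INR #|bad|.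
  by move/ltn_INR: bad_big; rewrite mult_INR (_ : INR 2 = 2) //; lra.
move/leq_INR: T_le => T_le removal_bad.
have b_N : 0 < INR #|bad| / N by apply: Rdiv_lt_0_compat; lra.
have key : c0 * N * Rpower (INR #|bad| / N) (/ c) <= rho.
  apply: (Rmult_le_reg_l (INR #|bad|)); first lra.
  apply: Rle_trans (Rle_trans _ _ _ (Rle_trans _ _ _ removal_bad T_le) bad_r).
  rewrite Rpower_plus Rpower_1 //; apply: Req_le; field; lra.
have mono : Rpower (/ 2) (/ c) * Rpower (INR #|J| / N) (/ c) <= Rpower (INR #|bad| / N) (/ c).
  rewrite Rpower_mult_distr; [|lra|by apply: Rdiv_lt_0_compat; lra].
  apply: Rle_Rpower_l; first exact/Rlt_le/Rinv_0_lt_compat.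
  have JN : 0 < INR #|J| / N by apply: Rdiv_lt_0_compat; lra.
  split; first lra.
  apply: (Rmult_le_reg_r N) => //; rewrite /Rdiv Rmult_assoc !(Rmult_assoc _ (/ N)) Rinv_l; lra.
have : 0 < c0 * N * (Rpower (/ 2) (/ c) * Rpower (INR #|J| / N) (/ c)).
  by do !apply: Rmult_lt_0_compat => //; apply: exp_pos.
have : c0 * N * (Rpower (/ 2) (/ c) * Rpower (INR #|J| / N) (/ c)) <= c0 * N * Rpower (INR #|bad| / N) (/ c).
  by apply: Rmult_le_compat_l => //; apply: Rmult_le_pos; lra.
move: key; rewrite /rho /c1; lra.
Qed.
End ThreeCycleRemoval.

(** * Longer cycles, up to a polynomial loss *)

Section Induction.
Variables (p : nat) (c : R).
Hypotheses (p_prime : prime p) (c_def : is_c_p3 p c).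
Let c_pos : 0 < c := c_p3_pos p_prime c_def.

(* The factor (B n)^B is harmless: it grows only polynomially under tensor powers. *)
Definition lossy_bound (m B : nat) : Prop :=
  forall n (X : nat -> {set 'rV['F_p]_n}) (J : finType) (f : nat -> J -> 'rV['F_p]_n),
  (0 < n)%nat -> (0 < #|J|)%nat -> disjoint_cycles m.+3 X f ->
  Rpower (INR #|J| / INR (expn p n)) (1 + INR m.+1 / c) * INR (expn p n) ^ m.+2 <=
    INR (B * n) ^ B * INR (reps m.+3 X 0%ring).

Lemma lossy_bound_base : exists2 B, (0 < B)%nat & lossy_bound 0 B.
Proof.
have [c0 c0_pos removal] := three_cycle_removal p_prime c_def.
have [B B_gt] := INR_unbounded (/ c0).
have ic0 : 0 < / c0 by apply: Rinv_0_lt_compat.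
have B_pos : (0 < B)%nat by apply/ssrnat.ltP/INR_lt; rewrite /=; lra.
exists B => // n X J f n_pos J_pos [f_inj fX f0].
rewrite reps3_triangles.
have N_pos := expn_p_pos p_prime n.
set N := INR (expn p n) in N_pos *; set T := INR #|triangles _|.
pose h j := (f 0%nat j, f 1%nat j).
have h_inj : injective h by move=> j j' [/(f_inj 0%nat isT)].
have corner_h i j : corner i (h j) = f i j.
  elim/ord3P: i; rewrite /corner //=.
  have := f0 j; rewrite !big_ord_recl big_ord0 /= addr0 addrA => /eqP.
  by rewrite addr_eq0 => /eqP ->; rewrite opprK.
have matchS : triangle_matching (fun i : 'I_3 => X i) (h @: setT).
  split=> [|i t t' /imsetP[j _ ->] /imsetP[j' _ ->]].
    apply/subsetP => t /imsetP[j _ ->]; rewrite inE; apply/forallP => i.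
    by rewrite corner_h; apply: fX.
  by rewrite !corner_h => /(f_inj i (ltn_ord i)) ->.
have card_h : #|h @: setT| = #|J| by rewrite card_imset // cardsT.
have := removal _ _ _ matchS; rewrite card_h -/N -/T => /(_ J_pos) bound.
have T_pos : 0 <= T by apply: pos_INR.
apply: (Rle_trans _ (/ c0 * T)).
  apply: (Rmult_le_reg_l c0) => //; rewrite -(Rmult_assoc c0 (/ c0)) Rinv_r ?Rmult_1_l; last lra.
  rewrite (_ : 1 + INR 1 / c = 1 + / c); last by rewrite /Rdiv Rmult_1_l.
  lra.
apply: Rmult_le_compat_r => //.
have Bn1 : 1 <= INR (B * n) by apply: (@leq_INR 1); rewrite muln_gt0 B_pos.
apply: (Rle_trans _ (INR (B * n))).
  by apply: Rle_trans (leq_INR (leq_pmulr B n_pos)); lra.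
by rewrite -{1}(pow_1 (INR _)); apply: Rle_pow => //; apply/ssrnat.leP.
Qed.

(** Keep the half of the matching with popular sums and merge the first two coordinates. Each merged
    cycle lifts to at least [c1 N (#|J| / N)^(1/c)] cycles, which adds [1 / c] to the exponent. *)
Lemma merge_step (m B : nat) : lossy_bound m B -> exists2 D, 0 < D &
  forall n (X : nat -> {set 'rV['F_p]_n}) (J : finType) (f : nat -> J -> 'rV['F_p]_n),
  (0 < n)%nat -> (0 < #|J|)%nat -> disjoint_cycles m.+4 X f ->
  injective (fun j => f 0%nat j + f 1%nat j)%ring ->
  Rpower (INR #|J| / INR (expn p n)) (1 + INR m.+2 / c) * INR (expn p n) ^ m.+3 <=
    D * INR (B * n) ^ B * INR (reps m.+4 X 0%ring).
Proof.
move=> IH; have [c1 c1_pos popular] := popular_sums p_prime c_def.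
pose e := 1 + INR m.+1 / c.
have e_pos : 0 < e.
  have := Rdiv_lt_0_compat (INR m.+1) c (lt_0_INR m.+1 (Nat.lt_0_succ m)) c_pos.
  rewrite /e; lra.
have e'E : 1 + INR m.+2 / c = / c + e by rewrite /e [INR m.+2]S_INR; field; lra.
pose D := / c1 * Rpower 2 e.
have D_pos : 0 < D by apply: Rmult_lt_0_compat; [exact: Rinv_0_lt_compat | exact: exp_pos].
exists D => // n X J f n_pos J_pos [f_inj fX f0] y_inj.
have N_pos := expn_p_pos p_prime n.
have [J' J_le rich] := popular n (X 0%nat) (X 1%nat) J (f 0%nat) (f 1%nat)
  (f_inj 0%nat isT) (f_inj 1%nat isT) y_inj (fun j => fX 0%nat j isT) (fun j => fX 1%nat j isT) J_pos.
set N := INR (expn p n) in N_pos rich *.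
pose K := {j : J | j \in J'}.
have cardK : #|{: K}| = #|J'| by rewrite card_sig; apply: eq_card.
pose y j := (f 0%nat j + f 1%nat j)%ring.
pose X2 i := if i is i'.+1 then X i'.+2 else [set y j | j in J'].
pose f2 i (j : K) := if i is i'.+1 then f i'.+2 (val j) else y (val j).
have cyc2 : disjoint_cycles m.+3 X2 f2.
  split=> [[|i] i_lt||j].
  - by move=> j j' /y_inj/val_inj.
  - by move=> j j' /(f_inj i.+2 i_lt)/val_inj.
  - by case=> [|i] j i_lt; [apply: imset_f; apply: valP | apply: fX].
  - have := f0 (val j); rewrite -!(big_mkord xpredT (fun i => f i (val j))) -!(big_mkord xpredT (fun i => f2 i j)).
    rewrite big_nat_recl // big_nat_recl // addrA => E.
    by rewrite big_nat_recl.
have K_pos : (0 < #|{: K}|)%nat by rewrite cardK; lia.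
have := IH n X2 K f2 n_pos K_pos cyc2; rewrite -/e -/N.
set T2 := reps _ X2 _; set T := reps _ X _ => IH2.
set rho := c1 * N * _ in rich.
have rho_pos : 0 < rho.
  by apply: Rmult_lt_0_compat; [apply: Rmult_lt_0_compat | exact: exp_pos].
have T_ge : rho * INR T2 <= INR T.
  have /leq_INR := reps_merge m.+2 X [set y j | j in J']; rewrite -/T.
  apply: Rle_trans.
  rewrite /T2 /=; set Y := [set _ | _ in _].
  have YP z : z \in Y -> rho <= INR (sum_reps (X 0%nat) (X 1%nat) z).
    by case/imsetP => j /rich + ->.
  have -> : (\sum_(x in Y) \sum_(z in X 2%nat) reps m.+1 (fun i => X i.+3) (0 - x - z)%ring =
     \sum_(x in Y) reps m.+2 (fun i => X i.+2) (- x)%ring)%nat.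
    by apply: eq_bigr => z _ /=; apply: eq_bigr => z' _; rewrite sub0r.
  elim/big_rec2: _ => [|z a b zY IHz]; first by rewrite /=; lra.
  rewrite !plus_INR mult_INR Rmult_plus_distr_l; apply: Rplus_le_compat => //.
  by apply: Rmult_le_compat_r; [exact: pos_INR | exact: YP].
have JN : 0 < INR #|J| / N by apply: Rdiv_lt_0_compat => //; apply: (@ltn_INR 0).
have half : Rpower (INR #|J| / N) e <= Rpower 2 e * Rpower (INR #|{: K}| / N) e.
  rewrite Rpower_mult_distr; [|lra|by apply: Rdiv_lt_0_compat => //; apply: (@ltn_INR 0)].
  apply: Rle_Rpower_l; first lra; split=> //.
  have := leq_INR J_le; rewrite -cardK mult_INR (_ : INR 2 = 2) // => JK.
  by rewrite /Rdiv -Rmult_assoc; apply: Rmult_le_compat_r => //; apply/Rlt_le/Rinv_0_lt_compat.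
rewrite e'E Rpower_plus.
set a := Rpower _ (/ c); set b := Rpower _ e in half *; set b' := Rpower (INR #|{: K}| / N) e in half IH2.
have a_pos : 0 < a by apply: exp_pos.
have rhoE : rho = c1 * N * a by [].
set L := INR (B * n) ^ B in IH2 *.
have L_pos : 0 <= L by apply: pow_le; exact: pos_INR.
apply: (Rle_trans _ (a * (Rpower 2 e * b') * N ^ m.+3)).
  apply: Rmult_le_compat_r; first exact/Rlt_le/pow_lt.
  by apply: Rmult_le_compat_l => //; lra.
apply: (Rle_trans _ (D * (rho * (L * INR T2)))).
  rewrite /D rhoE.
  have -> : a * (Rpower 2 e * b') * N ^ m.+3 = / c1 * Rpower 2 e * (c1 * N * a * (b' * N ^ m.+2)).
    by rewrite -[N ^ m.+3]/(N * N ^ m.+2); field; lra.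
  apply: Rmult_le_compat_l; first exact: Rlt_le D_pos.
  by apply: Rmult_le_compat_l => //; rewrite -rhoE; exact: Rlt_le.
have -> : D * (rho * (L * INR T2)) = D * L * (rho * INR T2) by ring.
by apply: Rmult_le_compat_l => //; apply: Rmult_le_pos => //; exact: Rlt_le.
Qed.

(** A matching has at most [p^n] members, so [p n + 2] rounds of resampling are enough, a number
    linear in [n]. *)
Lemma two_pow_bound n : (0 < n)%nat -> (2 * expn p n < expn 2 (p * n).+2)%nat.
Proof.
move=> n_pos; apply: (@leq_ltn_trans (expn 2 (p * n).+1)).
  by rewrite expnS leq_mul2l expnM leq_exp2r //= ltnW // ltn_expl.
by rewrite ltn_exp2l.
Qed.

(** Selection keeps at least a fraction [1 / (36 p n)] of the matching and makes one kind of sum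
    distinct. The losses are at most [(36 p n)^E], [D] and [(B n)^B]; [B' n] dominates each base and
    [B'] the total exponent. *)
Lemma lossy_bound_step (m B : nat) : (0 < B)%nat -> lossy_bound m B ->
  exists2 B', (0 < B')%nat & lossy_bound m.+1 B'.
Proof.
move=> B_pos IH; have [D D_pos merge] := merge_step IH.
pose e := 1 + INR m.+2 / c.
have e_pos : 0 < e.
  have := Rdiv_lt_0_compat (INR m.+2) c (lt_0_INR m.+2 (Nat.lt_0_succ _)) c_pos.
  rewrite /e; lra.
have [D' D'_gt] := INR_unbounded D; have [E E_gt] := INR_unbounded e.
pose B' := ((36 * p + D' + B) + (E + 1 + B))%nat.
have B'_pos : (0 < B')%nat by rewrite /B'; lia.
exists B' => // n X J f n_pos J_pos [f_inj fX f0].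
have N_pos := expn_p_pos p_prime n.
have p_gt0 := prime_gt0 p_prime.
(* Coordinates from 3 on are bundled and keep a common index, so a cycle becomes a zero sum of four
   terms. *)
pose f4 j := (\sum_(i < m.+1) f i.+3 j)%ring.
have sum0 j : (f 0%nat j + f 1%nat j + (f 2%nat j + f4 j) = 0)%ring.
  have := f0 j; rewrite -!(big_mkord xpredT (fun i => f i j)) /f4 -(big_mkord xpredT (fun i => f i.+3 j)).
  by rewrite !big_nat_recl // !addrA.
have J_small : (2 * #|J| < expn 2 (p * n).+2)%nat.
  apply: leq_ltn_trans (two_pow_bound n_pos); rewrite leq_mul2l /= -(card_row p_prime).
  exact: leq_card (f_inj 0%nat isT).
have [C [[C0 C1 C2 C3 C4] C_sum C_big]] := distinct_sum_selection (f_inj 1%nat isT) (f_inj 2%nat isT) sum0 J_small.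
pose K := {x | x \in C}.
have cardK : #|{: K}| = #|C| by rewrite card_sig; apply: eq_card.
pose g i (x : K) := match i with
  | 0 => f 0 (val x).1.1 | 1 => f 1 (val x).1.2 | 2 => f 2 (val x).2.1
  | _ => f i (val x).2.2 end%nat.
have cyc_g : disjoint_cycles m.+4 X g.
  split=> [[|[|[|i]]] i_lt x x'|[|[|[|i]]] x i_lt|x]; try exact: fX.
  - by move=> /(f_inj _ i_lt)/C1 E'; apply/val_inj/E'; apply: valP.
  - by move=> /(f_inj _ i_lt)/C2 E'; apply/val_inj/E'; apply: valP.
  - by move=> /(f_inj _ i_lt)/C3 E'; apply/val_inj/E'; apply: valP.
  - by move=> /(f_inj _ i_lt)/C4 E'; apply/val_inj/E'; apply: valP.
  - have /eqP := C0 _ (valP x); rewrite /f4 -(big_mkord xpredT (fun i => f i.+3 _)).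
    rewrite -(big_mkord xpredT (fun i => g i x)) !(big_nat_recl m.+3 0) //.
    by rewrite !(big_nat_recl m.+2 0) // (big_nat_recl m.+1 0) // !addrA.
have K_pos : (0 < #|{: K}|)%nat by rewrite cardK; case: #|C| C_big J_pos => //; rewrite mul0n; case: #|J|.
set N := INR (expn p n) in N_pos *; set L := INR (B * n) ^ B in merge *.
have boundK : Rpower (INR #|{: K}| / N) e * N ^ m.+3 <= D * INR (B * n) ^ B * INR (reps m.+4 X 0%ring).
  case: C_sum => sum_inj; first by apply: merge cyc_g _ => // x x' /sum_inj E'; apply/val_inj/E'; apply: valP.
  (* The sums of coordinates 0 and 2 are distinct here, so coordinates 1 and 2 are exchanged
     first. *)
  rewrite -reps_swap; set X' := fun i : nat => _.
  pose g' i := match i with 1 => g 2 | 2 => g 1 | _ => g i end%nat.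
  case: cyc_g => g_inj gX g0.
  apply: (merge n X' K g') => //; last by move=> x x' /sum_inj E'; apply/val_inj/E'; apply: valP.
  split=> [[|[|[|i]]] i_lt|[|[|[|i]]] x i_lt|x].
  - exact: g_inj. - exact: (g_inj 2%nat). - exact: (g_inj 1%nat). - exact: g_inj.
  - exact: gX. - exact: (gX 2%nat). - exact: (gX 1%nat). - exact: gX.
  - transitivity (\sum_(i < m.+4) g i x)%ring; last exact: g0.
    rewrite -(big_mkord xpredT (fun i => g i x)) -(big_mkord xpredT (fun i => g' i x)).
    rewrite !(big_nat_recl m.+3 0) // !(big_nat_recl m.+2 0) // !(big_nat_recl m.+1 0) //.
    by congr (_ + _)%ring; rewrite addrCA.
set T := INR (reps _ X _) in boundK *.
have T_pos : 0 <= T by apply: pos_INR.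
pose w := INR (36 * p * n).
have w_ge1 : 1 <= w by apply: (@leq_INR 1); rewrite !muln_gt0 p_gt0.
have JN : 0 < INR #|J| / N by apply: Rdiv_lt_0_compat => //; apply: (@ltn_INR 0).
have KN : 0 < INR #|{: K}| / N by apply: Rdiv_lt_0_compat => //; apply: (@ltn_INR 0).
have JK : Rpower (INR #|J| / N) e <= w ^ E * Rpower (INR #|{: K}| / N) e.
  apply: (Rle_trans _ (Rpower (w * (INR #|{: K}| / N)) e)).
    apply: Rle_Rpower_l; first lra; split=> //.
    rewrite /Rdiv -Rmult_assoc; apply: Rmult_le_compat_r; first exact/Rlt_le/Rinv_0_lt_compat.
    rewrite -mult_INR; apply: leq_INR; rewrite cardK; apply: leq_trans C_big _.
    rewrite mulnC leq_mul2r; apply/orP; right; nia.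
  rewrite -Rpower_mult_distr; [|lra|exact: KN].
  apply: Rmult_le_compat_r; first exact/Rlt_le/exp_pos.
  rewrite -Rpower_pow; last lra.
  case: w_ge1 => [w1|<-]; first by apply: Rle_Rpower; lra.
  by rewrite /Rpower ln_1 !Rmult_0_r; exact: Rle_refl.
pose b := INR (B' * n).
have b_ge1 : 1 <= b by apply: (@leq_INR 1); rewrite muln_gt0 B'_pos.
have w_b : w <= b by apply: leq_INR; rewrite /B'; nia.
have L_b : INR (B * n) <= b by apply: leq_INR; rewrite /B'; nia.
have D_b : D <= b.
  by apply: Rle_trans (Rlt_le _ _ D'_gt) _; apply: leq_INR; rewrite /B'; nia.
rewrite -/e -/b.
apply: (Rle_trans _ (w ^ E * (D * INR (B * n) ^ B * T))).
  apply: Rle_trans (Rmult_le_compat_r _ _ _ _ JK) _; first exact/Rlt_le/pow_lt.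
  rewrite Rmult_assoc; apply: Rmult_le_compat_l => //; apply: pow_le; lra.
rewrite -!Rmult_assoc; apply: Rmult_le_compat_r => //.
apply: (Rle_trans _ (b ^ E * b ^ 1 * b ^ B)).
  rewrite pow_1; apply: Rmult_le_compat; [| exact/pow_le/pos_INR | | apply: pow_incr; split => //; exact: pos_INR].
    by apply: Rmult_le_pos; [apply: pow_le; lra | lra].
  by apply: Rmult_le_compat; [apply: pow_le; lra | lra | apply: pow_incr; lra | ].
rewrite -!pow_add; apply: Rle_pow => //; apply/ssrnat.leP; rewrite /B'.
lia.
Qed.

Lemma lossy_bound_exists (m : nat) : exists2 B, (0 < B)%nat & lossy_bound m B.
Proof.
elim: m => [|m [B B_pos IH]]; first exact: lossy_bound_base.
exact: lossy_bound_step IH.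
Qed.

End Induction.

(** * Removing the loss by tensor powers *)

(** With [x = 2^s] and [l = ln q / (B + 1)], the right side is [exp (x l)^(B+1)], at least
    [(x l)^(B+1)], a polynomial in [x] of higher degree than the left side. *)
Lemma power_beats_polynomial (q A : R) (B : nat) : 1 < q -> 0 < A ->
  exists s, A * (2 ^ s) ^ B < q ^ expn 2 s.
Proof.
move=> q1 A_pos.
have lq : 0 < ln q by rewrite -ln_1; apply: ln_increasing; lra.
pose l := ln q / INR B.+1.
have B1 : 0 < INR B.+1 by apply: lt_0_INR; apply/ssrnat.ltP.
have l_pos : 0 < l by apply: Rdiv_lt_0_compat.
have lB_pos : 0 < l ^ B.+1 by apply: pow_lt.
have [s s_gt] := INR_unbounded (A / l ^ B.+1).
exists s; pose x := 2 ^ s.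
have x_pos : 0 < x by apply: pow_lt; lra.
have x_gt : A / l ^ B.+1 < x.
  apply: Rlt_le_trans s_gt _; rewrite /x -(_ : INR 2 = 2) // -(INR_expn 2 s).
  by apply: leq_INR; apply/ltnW/ltn_expl.
rewrite -/x; apply: (Rlt_le_trans _ ((x * l) ^ B.+1)).
  rewrite Rpow_mult_distr.
  have -> : A * x ^ B = A / l ^ B.+1 * (x ^ B * l ^ B.+1) by field; lra.
  have -> : x ^ B.+1 * l ^ B.+1 = x * (x ^ B * l ^ B.+1) by rewrite /=; ring.
  by apply: Rmult_lt_compat_r => //; apply: Rmult_lt_0_compat => //; apply: pow_lt.
have -> : q ^ expn 2 s = exp (x * l) ^ B.+1.
  rewrite -Rpower_pow; last lra.
  rewrite -Rpower_pow; last exact: exp_pos.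
  rewrite /Rpower ln_exp (INR_expn 2 s) (_ : INR 2 = 2) // -/x.
  by congr exp; rewrite /l; field; lra.
apply: pow_incr; split; first by apply: Rmult_le_pos; lra.
have := exp_ineq1_le (x * l); lra.
Qed.

Section Sharp.
Variables (p : nat) (c : R).
Hypotheses (p_prime : prime p) (c_def : is_c_p3 p c).

Lemma Rpower_pow_comm (x y : R) (n : nat) : 0 < x -> Rpower (x ^ n) y = Rpower x y ^ n.
Proof.
move=> x0; rewrite -(Rpower_pow n x) // -(Rpower_pow n (Rpower x y)); last exact: exp_pos.
by rewrite !Rpower_mult Rmult_comm.
Qed.

(** If the bound [b] exceeded the count [T], then under tensor powers [(b / T)^(2^s)] would stay
    below a polynomial in [2^s]. *)
Lemma sharp_bound (m n : nat) (X : nat -> {set 'rV['F_p]_n}) (J : finType) f :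
  (0 < n)%nat -> (0 < #|J|)%nat -> disjoint_cycles m.+3 X (f : nat -> J -> _) ->
  Rpower (INR #|J| / INR (expn p n)) (1 + INR m.+1 / c) * INR (expn p n) ^ m.+2 <=
    INR (reps m.+3 X 0%ring).
Proof.
move=> n_pos J_pos cyc.
have [B B_pos lossy] := lossy_bound_exists p_prime c_def m.
have N_pos := expn_p_pos p_prime n.
set N := INR (expn p n) in N_pos *; set e := 1 + INR m.+1 / c; set T := INR (reps _ _ _).
have JN : 0 < INR #|J| / N by apply: Rdiv_lt_0_compat => //; apply: (@ltn_INR 0).
set b := Rpower _ e * _.
have b_pos : 0 < b by apply: Rmult_lt_0_compat; [exact: exp_pos | exact: pow_lt].
have amplified s : b ^ expn 2 s <= (INR (B * n) ^ B * (2 ^ s) ^ B) * T ^ expn 2 s.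
  have [X' [J' [f' [cyc' J'E repsE]]]] := iterated_square s cyc.
  have J'_pos : (0 < #|J'|)%nat by rewrite J'E expn_gt0 J_pos.
  have ns_pos : (0 < n * expn 2 s)%nat by rewrite muln_gt0 n_pos expn_gt0.
  have := lossy _ X' J' f' ns_pos J'_pos cyc'; rewrite -/e.
  rewrite repsE J'E expnM !(INR_expn _ (expn 2 s)) -/N -/T.
  have -> : INR #|J| ^ expn 2 s / N ^ expn 2 s = (INR #|J| / N) ^ expn 2 s.
    by rewrite /Rdiv Rpow_mult_distr pow_inv.
  rewrite Rpower_pow_comm //.
  have -> : (N ^ expn 2 s) ^ m.+2 = (N ^ m.+2) ^ expn 2 s by rewrite -!pow_mult Nat.mul_comm.
  rewrite -Rpow_mult_distr -/b mulnA mult_INR (INR_expn 2 s) (_ : INR 2 = 2) //.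
  by rewrite Rpow_mult_distr.
(* The case [s = 0] already excludes [T = 0], so the ratio [b / T] can be formed. *)
have T_pos : 0 < T.
  have := amplified 0%nat; rewrite expn0 !pow_1 /= pow1 Rmult_1_r => bT.
  have T0 : 0 <= T by apply: pos_INR.
  case: T0 => // T0; move: bT; rewrite -T0 Rmult_0_r; lra.
apply: Rnot_lt_le => Tb.
have Bn_pos : 0 < INR (B * n) ^ B by apply: pow_lt; apply: (@ltn_INR 0); rewrite muln_gt0 B_pos.
have q1 : 1 < b / T by apply: (Rmult_lt_reg_r T) => //; rewrite /Rdiv Rmult_assoc Rinv_l; lra.
have [s s_gt] := power_beats_polynomial B q1 Bn_pos.
have := amplified s.
have -> : b ^ expn 2 s = (b / T) ^ expn 2 s * T ^ expn 2 s.
  by rewrite -Rpow_mult_distr; congr (_ ^ _); field; lra.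
move/(Rmult_le_reg_r _ _ _ (pow_lt _ _ T_pos)); lra.
Qed.
End Sharp.

Local Close Scope R_scope.

Theorem theorem4 (p : nat) (c : R) (k : nat) (eps : R) (n : nat)
  (X : 'I_k -> {set 'rV['F_p]_n})
  (S : {set {ffun 'I_k -> 'rV['F_p]_n}}) :
  prime p -> is_c_p3 p c -> (3 <= k)%N -> (0 < eps < 1)%R -> (1 <= n)%N ->
  disjoint_cycle_collection X S ->
  (INR #|S| >= eps * INR (p ^ n))%R ->
  (INR (num_kcycles X) >= Rpower eps (C_pk c k) * (INR (p ^ n)) ^ (k - 1))%R.
Proof.
Local Open Scope R_scope.
move=> p_prime c_def k3 [eps_pos eps1] n_pos [S_cyc S_dis] S_big.
have [m kE] : exists m, k = m.+3 by exists (k - 3)%nat; rewrite -addn3 subnK.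
subst k; have c_pos := c_p3_pos p_prime c_def.
have N_pos := expn_p_pos p_prime n.
(* The power in the statement is [Nat.pow], whereas the bounds above use [expn]. *)
have NE : INR (Nat.pow p n) = INR (expn p n) by rewrite pow_INR INR_expn.
rewrite NE in S_big *; set N := INR (expn p n) in N_pos S_big *.
pose J := {x | x \in S}.
have cardJ : #|{: J}| = #|S| by rewrite card_sig; apply: eq_card.
have S_pos : 0 < INR #|S| by apply: Rlt_le_trans (Rge_le _ _ S_big); apply: Rmult_lt_0_compat.
have J_pos : (0 < #|{: J}|)%nat by rewrite cardJ; apply/ssrnat.ltP/INR_lt.
(* [inord] extends families over ['I_k] to [nat] and agrees with them below [k]. *)
pose f i (j : J) := val j (inord i).
pose X' i := X (inord i).
have cyc : disjoint_cycles m.+3 X' f.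
  split=> [i ik j j' E|i j ik|j].
  - apply/eqP/negPn/negP => jj'.
    have := S_dis _ _ (valP j) (valP j') jj'.
    by move=> /forallP/(_ (inord i)); rewrite -/(f i j) E eqxx.
  - by have /andP[/forallP inX _] := S_cyc _ (valP j); apply: inX.
  - have /andP[_ /eqP sum0] := S_cyc _ (valP j).
    by rewrite -[RHS]sum0; apply: eq_bigr => i _; rewrite /f inord_val.
have := sharp_bound p_prime c_def n_pos J_pos cyc; rewrite cardJ -/N => bound.
apply: Rle_ge; apply: Rle_trans (Rle_trans _ _ _ bound _).
  rewrite subn1 /=; apply: Rmult_le_compat_r; first exact/Rlt_le/(pow_lt _ m.+2).
  have -> : C_pk c m.+3 = 1 + INR m.+1 / c.
    by rewrite /C_pk /C_p3 !S_INR; field; lra.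
  apply: Rle_Rpower_l.
    have := Rdiv_lt_0_compat _ _ (lt_0_INR m.+1 (Nat.lt_0_succ m)) c_pos; lra.
  split=> //; apply: (Rmult_le_reg_r N) => //.
  rewrite /Rdiv Rmult_assoc Rinv_l ?Rmult_1_r; [exact: Rge_le | lra].
apply: leq_INR; apply: leq_trans (reps_le_card _ _ _) _.
apply: subset_leq_card; apply/subsetP => x; rewrite !inE /is_kcycle.
move=> /andP[/forallP xX ->]; rewrite andbT; apply/forallP => i.
by have := xX i; rewrite /X' inord_val.
Qed.
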